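(* Let $x_0,y_0\in\mathbb{R}^2$ and let $r,R>0$ be such that \[ |x_0-y_0|>r+R\qquad \text{and}\qquad \frac{r}{R}<\frac{\sqrt{7}-2}{3}. \] Then the open set $\Omega=B_r(x_0)\cup B_R(y_0)\subseteq\mathbb{R}^2$ satisfies \[ \lambda_{1,\frac{1}{2}}(\Omega)<h_{\frac{1}{2}}(\Omega). \]
   Context: $B_\varrho(x)$ denotes the open disk of radius $\varrho$ centered at $x$. For an open set $\Omega\subseteq\mathbb{R}^2$ and $0<q<2$, \[ h_q(\Omega)=\inf\left\{\frac{\mathcal{H}^{1}(\partial E)}{|E|^{1/q}}\, :\, E\Subset\Omega \text{ non-empty open set with smooth boundary}\right\}, \] where $|\cdot|$ is the two-dimensional Lebesgue measure, $\mathcal{H}^{1}$ is the one-dimensional Hausdorff measure, and $E\Subset\Omega$ means that $\overline{E}$ is a compact subset of $\Omega$; moreover \[ \lambda_{1,q}(\Omega)=\inf_{u\in C^\infty_0(\Omega)} \left\{\int_\Omega |\nabla u|\,dx\, :\, \int_\Omega |u|^q\,dx=1\right\}, \] where $C^\infty_0(\Omega)$ is the space of smooth functions with compact support in $\Omega$. *)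

(* Defs.v *)
From HB Require Import structures.
From mathcomp Require Import all_boot all_order all_algebra.
From mathcomp Require Import all_classical all_reals all_analysis.

Set Implicit Arguments.
Unset Strict Implicit.
Unset Printing Implicit Defensive.

Import Order.TTheory GRing.Theory Num.Theory.
Import numFieldNormedType.Exports.

Local Open Scope classical_set_scope.
Local Open Scope ring_scope.

Section Plane.
Context {R : realType}.
Implicit Types (p x : R * R) (A E Omega : set (R * R)) (u : R * R -> R).

(* The library norm on [R * R] is the sup norm: it induces the usual topology
   and differentiability, but lengths and disks must be Euclidean. *)
Definition enorm p : R := Num.sqrt (p.1 ^+ 2 + p.2 ^+ 2).

Definition disk x (rho : R) : set (R * R) := [set p | enorm (p - x) < rho].

Definition boundary A : set (R * R) := closure A `\` A°.

Definition compactly_contained E Omega :=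
  compact (closure E) /\ closure E `<=` Omega.

Definition area A : \bar R :=
  (@lebesgue_measure R \x @lebesgue_measure R)%E A.

(* The point 0 is added so that the empty set has diameter 0 (and not -oo). *)
Definition diam A : \bar R :=
  ereal_sup ([set 0%:E] `|` [set (enorm (pq.1 - pq.2))%:E | pq in A `*` A]).

(* In dimension one the normalizing constant of the Hausdorff measure is 1. *)
Definition hausdorff1_pre (delta : R) A : \bar R :=
  ereal_inf [set (\sum_(0 <= i <oo) diam (U i))%E | U in
    [set U : nat -> set (R * R) |
      A `<=` \bigcup_i U i /\ forall i, (diam (U i) <= delta%:E)%E]].

Definition hausdorff1 A : \bar R :=
  ereal_sup [set hausdorff1_pre delta A | delta in [set d : R | 0 < d]].

Definition smooth_line (g : R -> R) :=
  forall (n : nat) (t : R), derivable (derive1n n g) t 1.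

Definition axis (b : bool) : R * R := if b then (0, 1) else (1, 0).

Definition partial (b : bool) u : R * R -> R := 'D_(axis b) u.

Definition smooth_plane u :=
  forall s : seq bool, let v := foldr partial u s in
    continuous v /\ forall b p, derivable v p (axis b).

Definition relabel (b : bool) p : R * R := if b then (p.2, p.1) else p.

(* Near each boundary point, after possibly exchanging the coordinates ([b])
   and reversing the second one ([c]), [E] is the part of a disk lying
   strictly above the graph of a smooth function. *)
Definition smooth_boundary E :=
  forall x, boundary E x ->
    exists (rho : R) (b c : bool) (g : R -> R),
      [/\ 0 < rho, smooth_line g &
        forall p, disk x rho p ->
          (E p <-> 0 < (-1) ^+ c * ((relabel b p).2 - g (relabel b p).1))].

Definition cheeger_const (q : R) Omega : \bar R :=
  ereal_inf [set (hausdorff1 (boundary E) / (area E `^ q^-1))%E | E in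
    [set E | [/\ E !=set0, open E, smooth_boundary E &
                 compactly_contained E Omega]]].

Definition closed_support u : set (R * R) := closure [set p | u p != 0].

(* [C^oo_0(Omega)]; its elements are extended by zero to the whole plane. *)
Definition test_function Omega u :=
  [/\ smooth_plane u, compact (closed_support u) & closed_support u `<=` Omega].

Definition grad u p : R * R := (partial false u p, partial true u p).

Definition integral_plane Omega u : \bar R :=
  (\int[@lebesgue_measure R \x @lebesgue_measure R]_(p in Omega) (u p)%:E)%E.

Definition lambda1 (q : R) Omega : \bar R :=
  ereal_inf [set integral_plane Omega (fun p => enorm (grad u p)) | u in
    [set u | test_function Omega u /\
             integral_plane Omega (fun p => `|u p| `^ q) = 1%:E]].

End Plane.

(* Main.v *)
Require Import Defs.
From mathcomp Require Import all_boot all_order all_algebra.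
From mathcomp Require Import all_classical all_reals all_analysis.
From mathcomp Require Import measurable_realfun ring lra.

Import Order.TTheory GRing.Theory Num.Theory.
Import numFieldNormedType.Exports.

Local Open Scope classical_set_scope.
Local Open Scope ring_scope.

(* Lower bound for [h]. For a disk [B] of radius [rho] centred at [c], every
   point of [E `&` B] lies on a segment from [c] to a point of the boundary of
   [E] inside [B] (follow the ray until it leaves [E]). A small set of diameter
   [d] inside [B] spans from [c] a cone of area at most [rho * d / 2], up to a
   factor close to 1, so covers of the boundary give
   [2 |E `&` B| / rho <= H^1(boundary E `&` B)]. This replaces the isoperimetric
   inequality; as [|E `&` B|] is also at most the area of [B], summing over both
   disks and using the bound on [r / R] yields [h >= 2 / (pi R ^ 3)].

   Upper bound for [lambda]. The competitor is close to [R ^ 2] on the big disk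
   and to [r ^ 2] on the small one, each step being smoothed by
   [exp (- eta / (s - |p - c| ^ 2))]. Since the area measure is transported by
   [|p - c| ^ 2] to [pi] times the Lebesgue measure of the half-line, the
   gradient integral is computed by the fundamental theorem of calculus, and
   [lambda <= 2 / (pi (r ^ 3 + R ^ 3))] in the limit.

   The value of [pi] is never needed: it is replaced throughout by
   [disk_const], the area of the unit disk. *)

Local Notation plane R := (measurableTypeR R * measurableTypeR R)%type.
Local Notation pushforward_measure :=
  measure_function_pushforward__canonical__measure_function_Measure.

(** * The Euclidean norm and the area measure *)

Lemma enorm_ge0 {R : realType} (p : R * R) : 0 <= enorm p.
Proof. exact: sqrtr_ge0. Qed.

Lemma sqr_enorm {R : realType} (p : R * R) :
  enorm p ^+ 2 = p.1 ^+ 2 + p.2 ^+ 2.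
Proof. by rewrite sqr_sqrtr// addr_ge0// sqr_ge0. Qed.

Lemma enorm_lt {R : realType} (p : R * R) (x : R) : 0 < x ->
  (enorm p < x) = (p.1 ^+ 2 + p.2 ^+ 2 < x ^+ 2).
Proof. by move=> x0; rewrite -sqr_enorm ltr_pXn2r// nnegrE ?enorm_ge0 ?ltW. Qed.

Lemma enorm0 {R : realType} : enorm (0 : R * R) = 0.
Proof. by rewrite /enorm/= expr0n/= addr0 sqrtr0. Qed.

Lemma enormN {R : realType} (p : R * R) : enorm (- p) = enorm p.
Proof. by rewrite /enorm/= !sqrrN. Qed.

Lemma enormB {R : realType} (p q : R * R) : enorm (p - q) = enorm (q - p).
Proof. by rewrite -enormN opprB. Qed.

Lemma enormZ {R : realType} (k : R) (p : R * R) :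
  enorm (k * p.1, k * p.2) = `|k| * enorm p.
Proof.
by rewrite /enorm/= !exprMn -mulrDr sqrtrM ?sqr_ge0// sqrtr_sqr.
Qed.

Lemma le_enorm1 {R : realType} (p : R * R) : `|p.1| <= enorm p.
Proof. by rewrite -sqrtr_sqr ler_wsqrtr// lerDl sqr_ge0. Qed.

Lemma le_enorm2 {R : realType} (p : R * R) : `|p.2| <= enorm p.
Proof. by rewrite -sqrtr_sqr ler_wsqrtr// lerDr sqr_ge0. Qed.

Lemma dot_le_enorm {R : realType} (p q : R * R) :
  p.1 * q.1 + p.2 * q.2 <= enorm p * enorm q.
Proof.
apply: (le_trans (ler_norm _)).
rewrite -(@ler_pXn2r _ 2)// ?nnegrE ?mulr_ge0 ?enorm_ge0//.
rewrite real_normK ?num_real// exprMn !sqr_enorm -subr_ge0.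
rewrite (_ : _ - _ = (p.1 * q.2 - p.2 * q.1) ^+ 2); last by ring.
exact: sqr_ge0.
Qed.

Lemma cross_le_enorm {R : realType} (p q : R * R) :
  `|p.1 * q.2 - p.2 * q.1| <= enorm p * enorm q.
Proof.
rewrite -(@ler_pXn2r _ 2)// ?nnegrE ?mulr_ge0 ?enorm_ge0//.
rewrite real_normK ?num_real// exprMn !sqr_enorm -subr_ge0.
rewrite (_ : _ - _ = (p.1 * q.1 + p.2 * q.2) ^+ 2); last by ring.
exact: sqr_ge0.
Qed.

Lemma enormD {R : realType} (p q : R * R) : enorm (p + q) <= enorm p + enorm q.
Proof.
rewrite -(@ler_pXn2r _ 2)// ?nnegrE ?addr_ge0 ?enorm_ge0//.
have := dot_le_enorm p q.
rewrite sqrrD !sqr_enorm/=; nra.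
Qed.

Lemma continuous_enorm {R : realType} : continuous (@enorm R).
Proof.
move=> p; apply: (@cvg_comp _ _ _ (fun q : R * R => q.1 ^+ 2 + q.2 ^+ 2) Num.sqrt);
  last exact: sqrt_continuous.
by apply: cvgD; apply: (@cvg_comp _ _ _ _ (fun x : R => x ^+ 2)
  _ _ _ _ (@exprn_continuous _ 2 _)); (exact: cvg_fst || exact: cvg_snd).
Qed.

Lemma open_disk {R : realType} (c : R * R) (rho : R) : open (disk c rho).
Proof.
rewrite [disk _ _](_ : _ = (fun p => enorm (p - c)) @^-1` [set x | x < rho]) //.
apply: open_comp; last exact: open_lt.
move=> p _; apply: (@cvg_comp _ _ _ (fun q : R * R => q - c) enorm).
  by apply: cvgB; [exact: cvg_id|exact: cvg_cst].
exact: continuous_enorm.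
Qed.

(** An open set is the union of the boxes with rational corners that it contains, and there are only
    countably many of them. This is how open sets enter the product sigma-algebra. *)
Lemma open_measurable_plane {R : realType} (A : set (R * R)) : open A ->
  measurable (A : set (measurableTypeR R * measurableTypeR R)).
Proof.
move=> oA.
pose box (i : (rat * rat) * (rat * rat)) : set (R * R) :=
  `]ratr i.1.1 : R, ratr i.1.2[%classic `*` `]ratr i.2.1 : R, ratr i.2.2[%classic.
pose F i := if `[< box i `<=` A >] then box i else set0.
have -> : A = \bigcup_i F i.
  apply/seteqP; split=> [p Ap|p [i _]]; last first.
    by rewrite /F; case: ifPn => // /asboolP iA /iA.
  have /nbhs_ballP[e/= e0 peA] : nbhs p A by exact: open_nbhs_nbhs.
  have [a] := @rat_in_itvoo R (p.1 - e) p.1 ltac:(lra).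
  have [b] := @rat_in_itvoo R p.1 (p.1 + e) ltac:(lra).
  have [c] := @rat_in_itvoo R (p.2 - e) p.2 ltac:(lra).
  have [d] := @rat_in_itvoo R p.2 (p.2 + e) ltac:(lra).
  rewrite !in_itv/= => /andP[d1 d2] /andP[c1 c2] /andP[b1 b2] /andP[a1 a2].
  exists ((a, b), (c, d)) => //; rewrite /F ifT.
    by split; rewrite /= in_itv/=; apply/andP; split.
  apply/asboolP => q [/=]; rewrite !in_itv/= => /andP[q1 q2] /andP[q3 q4].
  by apply: peA; split; rewrite /ball/= ltr_norml; apply/andP; split; lra.
apply: countable_bigcupT_measurable => // i.
rewrite /F; case: ifPn => // _; exact: measurableX.
Qed.

Lemma measurable_affine {R : realType} (a b : R) :
  measurable_fun setT ((fun x => a * x + b) : measurableTypeR R -> measurableTypeR R).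
Proof. by apply: measurable_funD => //; exact: measurable_funM. Qed.

(** As functions of [A] both sides are measures, so by uniqueness it suffices to compare them on
    half-open intervals. For [a < 0] the preimage is closed on the other side, which does not change
    its length. *)
Lemma lebesgue_measure_affine {R : realType} (a b : R) (A : set (measurableTypeR R)) :
  a != 0 -> measurable A ->
  (`|a|%:E * lebesgue_measure ((fun x => (a * x + b)%R) @^-1` A) =
   lebesgue_measure A)%E.
Proof.
move=> a0 mA.
suff itvE (X : set R) : ocitv X -> lebesgue_measure X =
    (`|a|%:E * lebesgue_measure ((fun x => (a * x + b)%R) @^-1` X))%E.
  have := @lebesgue_measure_unique R (mscale (NngNum (normr_ge0 a))
    (pushforward_measure
      lebesgue_measure (measurable_affine a b))).
  by move=> /(_ itvE A mA) ->.
move=> [[u v] _ <-] /=.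
have [a_lt0|a_gt0|a_eq0] := ltgtP a 0; last by rewrite a_eq0 eqxx in a0.
- have -> : (fun x => a * x + b) @^-1` `]u, v] = `[(v - b) / a, (u - b) / a[%classic.
    apply/seteqP; split=> x /=; rewrite !in_itv/= ler_ndivrMr// ltr_ndivlMr//; lra.
  rewrite !lebesgue_measure_itv/= !lte_fin ltr_nM2r ?invr_lt0// ltrD2r.
  case: ifPn => _; last by rewrite mule0.
  by rewrite -!EFinD -EFinM ltr0_norm//; congr EFin; field.
- have -> : (fun x => a * x + b) @^-1` `]u, v] = `](u - b) / a, (v - b) / a]%classic.
    apply/seteqP; split=> x /=; rewrite !in_itv/= ler_pdivlMr// ltr_pdivrMr//; lra.
  rewrite !lebesgue_measure_itv/= !lte_fin ltr_pM2r ?invr_gt0// ltrD2r.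
  case: ifPn => _; last by rewrite mule0.
  by rewrite -!EFinD -EFinM gtr0_norm//; congr EFin; field.
Qed.

Lemma measurable_affine_plane {R : realType} (a a' b b' : R) :
  measurable_fun setT
    ((fun p => (a * p.1 + b, a' * p.2 + b')) : plane R -> plane R).
Proof.
apply: measurable_fun_pair.
  exact: (measurableT_comp (measurable_affine a b) measurable_fst).
exact: (measurableT_comp (measurable_affine a' b') measurable_snd).
Qed.

(** A product measure is determined by its values on rectangles, where the claim splits into two
    one-dimensional ones. It serves below for dilations, translations and reflections. *)
Lemma area_affine {R : realType} (a a' b b' : R) (A : set (plane R)) :
  a != 0 -> a' != 0 -> measurable A ->
  (`|a * a'|%:E * area ((fun p => (a * p.1 + b, a' * p.2 + b')%R) @^-1` A) =
   area A)%E.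
Proof.
move=> a0 a'0 mA.
have := @product_measure_unique _ _ _ _ R lebesgue_measure lebesgue_measure
  (mscale (NngNum (normr_ge0 (a * a')))
    (pushforward_measure
      (lebesgue_measure \x lebesgue_measure)%E
      (measurable_affine_plane a a' b b'))).
move=> prodE; rewrite [RHS]/area (prodE _ A mA) // => X Y mX mY.
transitivity (lebesgue_measure X * lebesgue_measure Y)%E; last by [].
rewrite -(lebesgue_measure_affine a b X)// -(lebesgue_measure_affine a' b' Y)//.
rewrite [RHS]muleACA -EFinM -normrM /mscale/=; congr (_ * _)%E.
rewrite /pushforward -product_measure1E//.
  by rewrite -[X in measurable X]setTI; exact: measurable_affine.
by rewrite -[X in measurable X]setTI; exact: measurable_affine.
Qed.

Lemma measurable_swap {R : realType} :
  measurable_fun setT ((fun p => (p.2, p.1)) : plane R -> plane R).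
Proof. by apply: measurable_fun_pair; [exact: measurable_snd|exact: measurable_fst]. Qed.

Lemma area_swap {R : realType} (A : set (plane R)) : measurable A ->
  area ((fun p => (p.2, p.1)) @^-1` A) = area A.
Proof.
move=> mA; apply/esym.
have := @product_measure_unique _ _ _ _ R lebesgue_measure lebesgue_measure
  (pushforward_measure
      (lebesgue_measure \x lebesgue_measure)%E measurable_swap).
move=> prodE; rewrite [LHS]/area (prodE _ A mA) // => X Y mX mY.
rewrite /= /pushforward muleC -product_measure1E//.
suff -> : (fun p => (p.2, p.1)) @^-1` (X `*` Y) = Y `*` X by [].
by apply/seteqP; split=> -[x y] /= [].
Qed.

Lemma le_area {R : realType} (A B : set (plane R)) : measurable A -> measurable B ->
  A `<=` B -> (area A <= area B)%E.
Proof. by move=> mA mB AB; apply: le_measure; rewrite ?inE. Qed.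

Lemma area_ge0 {R : realType} (A : set (plane R)) : (0 <= area A)%E.
Proof. exact: measure_ge0. Qed.

Lemma area0 {R : realType} : area (set0 : set (R * R)) = 0%E.
Proof. exact: measure0. Qed.

Lemma measurable_disk {R : realType} (c : R * R) (rho : R) :
  measurable (disk c rho : set (plane R)).
Proof. by apply: open_measurable_plane; exact: open_disk. Qed.

Lemma area_box {R : realType} (a b c d : R) : a <= b -> c <= d ->
  area (`[a, b]%classic `*` `[c, d]%classic : set (R * R)) = ((b - a) * (d - c))%:E.
Proof.
move=> ab cd; rewrite /area product_measure1E//= !lebesgue_measure_itv/= !lte_fin.
have sub (x y : R) : x <= y -> (if (x < y)%R then y%:E - x%:E else 0)%E = (y - x)%:E.
  by move=> xy; case: ltP => // yx; congr EFin; lra.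
by rewrite !sub.
Qed.

Definition disk_const (R : realType) : R := fine (area (disk (0 : R * R) 1)).

Lemma disk1_fin_num {R : realType} : area (disk (0 : R * R) 1) \is a fin_num.
Proof.
rewrite ge0_fin_numE ?area_ge0//.
apply: (@le_lt_trans _ _ (area (`[(-1)%R : R, 1%R]%classic `*` `[(-1)%R : R, 1%R]%classic))).
  apply: le_area; [exact: measurable_disk|exact: measurableX|].
  move=> p; rewrite /disk/= subr0 => p1; split => /=; rewrite in_itv/= -ler_norml.
    exact: (le_trans (le_enorm1 p) (ltW p1)).
  exact: (le_trans (le_enorm2 p) (ltW p1)).
by rewrite area_box ?ltry//; lra.
Qed.

Lemma disk_const_gt0 {R : realType} : 0 < disk_const R.
Proof.
apply: fine_gt0; rewrite -ge0_fin_numE ?area_ge0// disk1_fin_num andbT.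
apply: (@lt_le_trans _ _ (area (`[(-2^-1)%R : R, 2^-1%R]%classic `*`
    `[(-2^-1)%R : R, 2^-1%R]%classic))).
  by rewrite area_box ?lte_fin; lra.
apply: le_area; [exact: measurableX|exact: measurable_disk|].
move=> p [] /=; rewrite !in_itv/= => /andP[a b] /andP[c d].
by rewrite /disk/= subr0 enorm_lt//; nra.
Qed.

Lemma area_disk {R : realType} (c : R * R) (rho : R) : 0 < rho ->
  area (disk c rho) = (disk_const R * rho ^+ 2)%:E.
Proof.
move=> rho0.
rewrite -(area_affine rho rho c.1 c.2) ?gt_eqF//; last exact: measurable_disk.
have -> : (fun p : R * R => (rho * p.1 + c.1, rho * p.2 + c.2)) @^-1` disk c rho =
    disk 0 1.
  apply/seteqP; split=> p; rewrite /disk/= !enorm_lt//= subr0 !addrK expr1n.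
    by rewrite subr0 !exprMn -mulrDr gtr_pMr ?exprn_gt0.
  by rewrite subr0 !exprMn -mulrDr gtr_pMr ?exprn_gt0.
by rewrite EFinM muleC /disk_const fineK ?disk1_fin_num// gtr0_norm ?mulr_gt0// -expr2.
Qed.

(** * Areas of thin cones *)

(** The triangle with apex at the origin, between the lines of slopes [m] and [m + w], cut off by
    the vertical line of abscissa [X]. *)
Definition wedge {R : realType} (m w X : R) : set (plane R) :=
  [set p | 0 <= p.1 <= X /\ m * p.1 <= p.2 <= (m + w) * p.1].

Lemma measurable_wedge {R : realType} (m w X : R) : measurable (wedge m w X).
Proof.
have lin (k : R) : measurable_fun setT (fun p : plane R => p.2 - k * p.1).
  by apply: measurable_funB => //; exact: measurable_funM.
rewrite (_ : wedge m w X = (`[0, X]%classic `*` setT) `&`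
   ((fun p : plane R => p.2 - m * p.1) @^-1` `[0, +oo[%classic `&`
    (fun p : plane R => p.2 - (m + w) * p.1) @^-1` `]-oo, 0]%classic)).
  apply: measurableI; first exact: measurableX.
  by apply: measurableI; rewrite -[X in measurable X]setTI; apply: lin.
apply/seteqP; split=> p /=; rewrite !in_itv/= andbT subr_ge0 subr_le0.
  by case=> ? /andP[].
by move=> [[? _] [? ?]]; split=> //; apply/andP.
Qed.

Lemma area_wedge {R : realType} (m w X : R) : 0 <= w -> 0 <= X ->
  area (wedge m w X) = (w * X ^+ 2 / 2)%:E.
Proof.
(* The degenerate triangle is treated apart, since the fundamental theorem of calculus is applied on
   a nontrivial interval. *)
move=> w0; rewrite le_eqVlt => /predU1P[<-|X0].
  rewrite expr0n/= mulr0 mul0r; apply/eqP; rewrite eq_le area_ge0 andbT.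
  have := @area_box R 0 0 0 0 (lexx _) (lexx _); rewrite subrr mul0r => <-.
  apply: le_area; [exact: measurable_wedge|exact: measurableX|].
  move=> [x y] [] /=; rewrite !in_itv/= => /le_anti <-.
  by rewrite !mulr0 lexx.
rewrite /area /product_measure1.
transitivity (\int[lebesgue_measure]_(x in `[0%R, X]) (w * x)%:E)%E.
  rewrite [RHS]integral_mkcond; apply: eq_integral => x _ /=.
  rewrite patchE; case: ifPn => [|/negP] ; rewrite inE/= in_itv/= => xX.
    rewrite (_ : xsection _ _ = `[m * x, (m + w) * x]%classic).
      have /andP[x0 _] := xX.
      rewrite lebesgue_measure_itv/= lte_fin; case: ltP => h; congr EFin; nra.
    by apply/seteqP; split=> y /=; rewrite /xsection/= inE /wedge/= in_itv/=; [case|split].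
  rewrite (_ : xsection _ _ = set0) ?measure0//.
  by apply/seteqP; split=> y //=; rewrite /xsection/= inE /wedge/= => -[].
pose F (x : R) := w / 2 * x ^+ 2.
have dF (x : R) : is_derive x 1 F (w * x).
  apply: is_derive_eq; rewrite /GRing.scale/= mulr1.
  by field.
rewrite (@continuous_FTC2 R (fun x => w * x) F 0 X)//.
- by rewrite /F expr0n/= mulr0 sube0; congr EFin; field.
- apply: continuous_subspaceT => x; apply: cvgM; [exact: cvg_cst|exact: cvg_id].
- have cF x : {for x, continuous F}.
    by apply/differentiable_continuous/derivable1_diffP; exact: ex_derive.
  split=> [x _||]; first exact: ex_derive.
    exact/cvg_at_right_filter/cF.
  exact/cvg_at_left_filter/cF.
- by move=> x _; rewrite derive1E derive_val.
Qed.

(** The cone over [V] with apex at the origin has outer area at most [B]. The set [V] will come from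
    an arbitrary cover, so its cone may fail to be measurable; a measurable superset [K] stands in
    for it. *)
Definition cone_area_le {R : realType} (V : set (R * R)) (B : R) :=
  exists2 K : set (plane R), measurable K /\ (area K <= B%:E)%E &
    forall p t, V p -> 0 <= t <= 1 -> K (t * p.1, t * p.2).

(** The slopes of two points [p] and [q] of [V] differ by the cross product of [p] and [q - p]
    divided by [p.1 * q.1], hence by at most [rho * d / a ^+ 2]. The cone therefore fits in a wedge
    that starts at the infimum of the slopes. *)
Lemma cone_area_le_right {R : realType} (V : set (R * R)) (rho d a X : R) :
  0 < rho -> 0 <= d -> 0 < a -> 0 <= X ->
  (forall p, V p -> enorm p <= rho) ->
  (forall p q, V p -> V q -> enorm (p - q) <= d) ->
  (forall p, V p -> a <= p.1 <= X) ->
  cone_area_le V (rho * d / a ^+ 2 * X ^+ 2 / 2).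
Proof.
move=> rho0 d0 a0 X0 Vrho Vd VX.
have w0 : 0 <= rho * d / a ^+ 2.
  by rewrite divr_ge0// ?mulr_ge0 ?exprn_ge0// ltW.
have [[p0 Vp0]|V0] := pselect (V !=set0); last first.
  exists set0; first by rewrite area0 lee_fin divr_ge0// mulr_ge0 ?exprn_ge0.
  by move=> p t Vp _; apply: V0; exists p.
have slope p q : V p -> V q -> p.2 / p.1 <= q.2 / q.1 + rho * d / a ^+ 2.
  move=> Vp Vq.
  have /andP[pa _] := VX _ Vp; have /andP[qa _] := VX _ Vq.
  have p10 : 0 < p.1 by lra.
  have q10 : 0 < q.1 by lra.
  have cr : p.2 * q.1 - p.1 * q.2 <= rho * d.
    rewrite (_ : _ - _ = p.2 * (q - p).1 - p.1 * (q - p).2); last by rewrite /=; ring.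
    apply: (le_trans (ler_norm _)); rewrite -normrN opprB.
    apply: (le_trans (cross_le_enorm _ _)).
    by apply: ler_pM; rewrite ?enorm_ge0//; [exact: Vrho|exact: Vd].
  rewrite -lerBlDl (_ : _ - _ = (p.2 * q.1 - p.1 * q.2) / (p.1 * q.1)); last first.
    by field; rewrite !gt_eqF.
  apply: (@le_trans _ _ (rho * d / (p.1 * q.1))).
    by rewrite ler_pM2r// invr_gt0 mulr_gt0.
  apply: ler_wpM2l; first by rewrite mulr_ge0// ltW.
  rewrite lef_pV2 ?posrE ?mulr_gt0 ?exprn_gt0// expr2.
  by apply: ler_pM => //; exact: ltW.
pose S := [set p.2 / p.1 | p in V].
have infS : has_inf S.
  split; first by exists (p0.2 / p0.1), p0.
  exists (p0.2 / p0.1 - rho * d / a ^+ 2) => _ [p Vp <-].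
  by rewrite lerBlDr slope.
exists (wedge (inf S) (rho * d / a ^+ 2) X).
  by split; [exact: measurable_wedge|rewrite area_wedge].
move=> p t Vp /andP[t0 t1]; have /andP[pa pX] := VX _ Vp.
have p10 : 0 < p.1 by lra.
have l1 : inf S <= p.2 / p.1 by apply: ge_inf; [exact: infS.2|exists p].
have l2 : p.2 / p.1 - rho * d / a ^+ 2 <= inf S.
  apply: lb_le_inf; first exact: infS.1.
  by move=> _ [q Vq <-]; rewrite lerBlDr slope.
rewrite /wedge/=; split.
  by apply/andP; split; [exact: mulr_ge0 t0 (ltW p10)|nra].
rewrite !(mulrCA _ t); apply/andP; split; apply: ler_wpM2l => //.
  by rewrite -ler_pdivlMr.
by rewrite -ler_pdivrMr// -lerBlDr.
Qed.

(** A map that preserves area and commutes with scalings carries cones to cones. Its instances, a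
    reflection and the exchange of coordinates, reduce every direction to the right half-plane. *)
Lemma cone_area_le_preimage {R : realType} (f : plane R -> plane R)
    (V : set (R * R)) (B : R) :
  measurable_fun setT f ->
  (forall A : set (plane R), measurable A -> area (f @^-1` A) = area A) ->
  (forall p t, f (t * p.1, t * p.2) = (t * (f p).1, t * (f p).2)) ->
  cone_area_le (f @` V) B -> cone_area_le V B.
Proof.
move=> mf areaf homf [K [mK KB] VK]; exists (f @^-1` K).
  split; first by rewrite -[X in measurable X]setTI; exact: mf.
  by rewrite areaf.
by move=> p t Vp t01; rewrite /= homf; apply: VK => //; exists p.
Qed.

Lemma cone_area_le_reflect {R : realType} (V : set (R * R)) (B : R) :
  cone_area_le [set (- p.1, p.2) | p in V] B -> cone_area_le V B.
Proof.
have fE : (fun p : R * R => (- p.1, p.2)) =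
    (fun p : plane R => (-1 * p.1 + 0, 1 * p.2 + 0)).
  by apply/funext => p; rewrite mulN1r mul1r !addr0.
apply: (@cone_area_le_preimage R (fun p => (- p.1, p.2))).
- by rewrite fE; exact: measurable_affine_plane.
- move=> A mA; rewrite fE -(area_affine (-1) 1 0 0 A)//.
  by rewrite mulr1 normrN normr1 mul1e.
- by move=> p t; rewrite /= mulrN.
Qed.

Lemma cone_area_le_swap {R : realType} (V : set (R * R)) (B : R) :
  cone_area_le [set (p.2, p.1) | p in V] B -> cone_area_le V B.
Proof.
apply: (@cone_area_le_preimage R (fun p => (p.2, p.1))) => //.
- exact: measurable_swap.
- by move=> A mA; rewrite area_swap.
Qed.

(* The constant [1 + 2 / tau] makes the first coordinate vary on [V] by a
   factor of at most [1 + tau]. *)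
Lemma cone_area_le_far {R : realType} (V : set (R * R)) (rho d tau : R)
    (p0 : R * R) :
  0 < rho -> 0 <= d -> 0 < tau ->
  (forall p, V p -> enorm p <= rho) ->
  (forall p q, V p -> V q -> enorm (p - q) <= d) ->
  V p0 -> (1 + 2 / tau) * d < p0.1 ->
  cone_area_le V ((1 + tau) ^+ 2 * rho / 2 * d).
Proof.
move=> rho0 d0 tau0 Vrho Vd Vp0 far.
(* The second inequality says that [(p0.1 + d) / (p0.1 - d)] is below [1 + tau]; its square is the
   loss factor in the wedge area. *)
have [far1 far2] : d < p0.1 /\ d * 2 < tau * (p0.1 - d).
  have : tau * ((1 + 2 / tau) * d) < tau * p0.1 by rewrite ltr_pM2l.
  rewrite mulrA mulrDr mulr1 (mulrC tau (2 / tau)) divfK ?gt_eqF// => h.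
  by split; nra.
have a0 : 0 < p0.1 - d by lra.
have VX p : V p -> p0.1 - d <= p.1 <= p0.1 + d.
  move=> Vp; have := le_trans (le_enorm1 _) (Vd _ _ Vp Vp0).
  by rewrite ler_norml /= => /andP[? ?]; apply/andP; split; lra.
have X0 : 0 <= p0.1 + d by lra.
have [K [mK KB] VK] := cone_area_le_right V rho d _ _ rho0 d0 a0 X0 Vrho Vd VX.
exists K => //; split => //; apply: (le_trans KB); rewrite lee_fin.
have -> : rho * d / (p0.1 - d) ^+ 2 * (p0.1 + d) ^+ 2 / 2 =
    ((p0.1 + d) / (p0.1 - d)) ^+ 2 * (rho / 2 * d).
  by field; rewrite gt_eqF.
rewrite -2!(mulrA ((1 + tau) ^+ 2)) ler_wpM2r//.
  by rewrite mulr_ge0// divr_ge0// ltW.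
rewrite ler_pXn2r// ?nnegrE.
- by rewrite ler_pdivrMr//; lra.
- by rewrite divr_ge0//; lra.
- by lra.
Qed.

(** The cone stays in a square centred at the origin. Its area is quadratic in [d], hence negligible
    against the desired linear bound once [d] is small. *)
Lemma cone_area_le_near {R : realType} (V : set (R * R)) (C d : R) :
  0 <= d -> 0 <= C ->
  (forall p, V p -> `|p.1| <= C * d /\ `|p.2| <= C * d) ->
  cone_area_le V (4 * C ^+ 2 * d * d).
Proof.
move=> d0 C0 VC; have Cd := mulr_ge0 C0 d0.
exists (`[- (C * d), C * d]%classic `*` `[- (C * d), C * d]%classic).
  split; first exact: measurableX.
  rewrite area_box ?lee_fin; [|lra|lra].
  by rewrite le_eqVlt; apply/orP; left; apply/eqP; ring.
have sc t x : 0 <= t <= 1 -> `|x| <= C * d -> - (C * d) <= t * x <= C * d.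
  move=> /andP[t0 t1] xC; rewrite -ler_norml normrM ger0_norm//.
  by apply: le_trans xC; rewrite -[leRHS]mul1r ler_wpM2r.
by move=> p t /VC[p1 p2] t01; split; rewrite /= in_itv/=; exact: sc.
Qed.

(** Either some point of [V] has a coordinate of size above [C * d], and the wedge estimate applies
    after a symmetry, or all of [V] lies in a square of side [2 * C * d]. *)
Lemma cone_area_le_small {R : realType} (eps rho : R) : 0 < eps -> 0 < rho ->
  exists2 delta : R, 0 < delta & forall (V : set (R * R)) d, 0 <= d <= delta ->
    (forall p, V p -> enorm p <= rho) ->
    (forall p q, V p -> V q -> enorm (p - q) <= d) ->
    cone_area_le V ((1 + eps) * rho / 2 * d).
Proof.
move=> eps0 rho0; pose tau := Num.min 1 (eps / 3).
have tau0 : 0 < tau by rewrite lt_min ltr01 divr_gt0.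
have tau1 : (1 + tau) ^+ 2 <= 1 + eps.
  have t1 : tau <= 1 by rewrite ge_min lexx.
  have t2 : tau <= eps / 3 by rewrite ge_min lexx orbT.
  have : tau * tau <= tau by rewrite -[leRHS]mulr1 ler_wpM2l// ltW.
  by nra.
pose C := 1 + 2 / tau; have C0 : 0 < C by rewrite addr_gt0// divr_gt0.
(* For [d] below this value the area [4 * C ^+ 2 * d * d] of the square is at most [rho / 2 * d]. *)
exists (rho / (8 * C ^+ 2)).
  by rewrite divr_gt0// mulr_gt0// exprn_gt0.
move=> V d /andP[d0 ddelta] Vrho Vd.
have le_cone B : B <= (1 + eps) * rho / 2 * d -> cone_area_le V B ->
    cone_area_le V ((1 + eps) * rho / 2 * d).
  move=> BB [K [mK KB] VK]; exists K => //; split => //.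
  by apply: (le_trans KB); rewrite lee_fin.
have far (W : set (R * R)) : (forall p, W p -> enorm p <= rho) ->
    (forall p q, W p -> W q -> enorm (p - q) <= d) ->
    (exists2 p, W p & C * d < p.1) ->
    cone_area_le W ((1 + tau) ^+ 2 * rho / 2 * d).
  by move=> Wrho Wd [p0 Wp0 p0far]; exact: cone_area_le_far Wp0 p0far.
have far' (W : set (R * R)) : (forall p, W p -> enorm p <= rho) ->
    (forall p q, W p -> W q -> enorm (p - q) <= d) ->
    (exists2 p, W p & C * d < `|p.1|) ->
    cone_area_le W ((1 + tau) ^+ 2 * rho / 2 * d).
  move=> Wrho Wd [p0 Wp0]; rewrite lter_normr => /orP[p0far|p0far].
    by apply: far => //; exists p0.
  apply: cone_area_le_reflect; apply: far.
  - move=> _ [p Wp <-]; have := Wrho _ Wp.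
    by rewrite /enorm/= sqrrN.
  - move=> _ _ [p Wp <-] [q Wq <-]; have := Wd _ _ Wp Wq.
    by rewrite /enorm/= -opprD sqrrN.
  - by exists (- p0.1, p0.2) => //; exists p0.
have tauB : (1 + tau) ^+ 2 * rho / 2 * d <= (1 + eps) * rho / 2 * d.
  by rewrite !ler_wpM2r// ltW.
have [h1|h1] := pselect (exists2 p, V p & C * d < `|p.1|).
  exact: (le_cone _ tauB (far' _ Vrho Vd h1)).
have [[p0 Vp0 h2]|h2] := pselect (exists2 p, V p & C * d < `|p.2|).
  apply: (le_cone _ tauB); apply: cone_area_le_swap; apply: far'.
  - move=> _ [p Vp <-]; have := Vrho _ Vp.
    by rewrite /enorm/= addrC.
  - move=> _ _ [p Vp <-] [q Vq <-]; have := Vd _ _ Vp Vq.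
    by rewrite /enorm/= addrC.
  - by exists (p0.2, p0.1) => //; exists p0.
apply: (@le_cone (4 * C ^+ 2 * d * d)).
  apply: ler_wpM2r => //.
  have : d * (8 * C ^+ 2) <= rho.
    by rewrite -ler_pdivlMr// mulr_gt0// exprn_gt0.
  have : 0 <= C * d by rewrite mulr_ge0// ltW.
  by nra.
apply: cone_area_le_near => //; first exact: ltW.
by move=> p Vp; split; rewrite leNgt; apply/negP => h; [apply: h1|apply: h2]; exists p.
Qed.

(** * Boundary length against area *)

(* The first exit point from [E] along the ray issued from [p]. *)
Lemma boundary_ray {R : realType} (E D : set (R * R)) (p v : R * R) (M : R) :
  open E -> open D -> E p -> D p -> v != 0 ->
  (forall q, D q -> enorm (q - p) <= M) ->
  (forall q, closure E q -> closure D q -> D q) ->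
  exists2 s : R, 0 <= s & boundary E (p + s *: v) /\ D (p + s *: v).
Proof.
move=> oE oD Ep Dp v0 DM EDD.
have v_gt0 : 0 < enorm v.
  rewrite lt_neqAle enorm_ge0 andbT eq_sym; apply: contra_neq v0 => v0.
  have := le_enorm1 v; have := le_enorm2 v; rewrite v0 !normr_le0.
  by case: v {v0} => a b /= /eqP -> /eqP ->.
pose g s := p + s *: v.
have cg : continuous g.
  move=> s; apply: cvgD; first exact: cvg_cst.
  exact: scalel_continuous.
(* [S] need not be an interval. The point at [sup S] is a limit of points of [E] and of [D], hence
   lies in [D] by the closure hypothesis; were it in [E], openness would put a larger parameter in
   [S]. *)
pose S := [set s | 0 <= s /\ E (g s) /\ D (g s)].
have S0 : S 0 by rewrite /S/= /g scale0r addr0.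
have supS : has_sup S.
  split; first by exists 0.
  exists (M / enorm v) => s [s0 [_ /DM]].
  rewrite /g addrC addKr ler_pdivlMr// => sM; apply: le_trans sM.
  by rewrite -[X in X * _ <= _]ger0_norm// -enormZ.
have s0 : 0 <= sup S by exact: sup_upper_bound.
have clS (A : set (R * R)) : (forall s, S s -> A (g s)) -> closure A (g (sup S)).
  move=> SA B nB.
  have [s [Ss Bs]] := @closure_sup _ S supS.1 supS.2 _ (cg _ _ nB).
  by exists (g s); split => //; exact: SA.
have clE : closure E (g (sup S)) by apply: clS => s [_ []].
have Dg : D (g (sup S)) by apply: EDD => //; apply: clS => s [_ []].
exists (sup S) => //; split => //; split => // /interior_subset Eg.
have /nbhs_ballP[e/= e0 eS] : nbhs (sup S) (g @^-1` (E `&` D)).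
  by apply: cg; apply: open_nbhs_nbhs; split; [exact: openI|].
have /eS[Ee De] : ball (sup S) e (sup S + e / 2).
  rewrite /ball/= opprD addNKr normrN gtr0_norm; lra.
have : S (sup S + e / 2) by split=> //; lra.
by move=> /(sup_upper_bound supS); lra.
Qed.

(** The ray from [p] pointing away from [c] meets the boundary at some [q] with [q - c] equal to
    [1 + s] times [p - c], whence [t = (1 + s)^-1]. The closure hypothesis keeps [q] off the
    bounding circle. *)
Lemma disk_cone_boundary {R : realType} (E : set (R * R)) (c : R * R) (rho : R) :
  open E ->
  (forall q, closure E q -> closure (disk c rho) q -> disk c rho q) ->
  forall p, E p -> disk c rho p ->
  exists t q, [/\ 0 <= t <= 1, boundary E q, disk c rho q &
    p = (t * (q.1 - c.1) + c.1, t * (q.2 - c.2) + c.2)].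
Proof.
move=> oE EDD p Ep Dp.
(* At the centre any nonzero direction serves, and [t] is then 0. *)
pose v := if p == c then (1, 0) else p - c.
have v0 : v != 0.
  rewrite /v; case: ifPn => [_|]; last by rewrite subr_eq0.
  by apply/eqP => -[] /eqP; rewrite oner_eq0.
have DM q : disk c rho q -> enorm (q - p) <= rho + rho.
  rewrite /disk/= => Dq; rewrite -(subrK c q) -addrA.
  apply: (le_trans (enormD _ _)); apply: lerD; first exact: ltW.
  by rewrite enormB; exact: ltW.
have [s s0 [bq Dq]] := boundary_ray E (disk c rho) p v _ oE (open_disk c rho) Ep Dp v0 DM EDD.
have [pc|pc] := eqVneq p c.
  exists 0, (p + s *: v); split => //; first by rewrite lexx ler01.
  by rewrite !mul0r !add0r pc; case: c {EDD v v0 DM bq Dq pc Dp}.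
have s1 : 0 < 1 + s by lra.
exists (1 + s)^-1, (p + s *: v); split => //.
  by rewrite invr_ge0 ltW//= invf_le1//; lra.
rewrite /v (negbTE pc).
case: p c {EDD v v0 DM bq Dq pc Dp Ep} => [p1 p2] [c1 c2] /=.
by congr pair; rewrite /GRing.scale/=; field; rewrite gt_eqF.
Qed.

Lemma diam_ge0 {R : realType} (A : set (R * R)) : (0 <= diam A)%E.
Proof. by apply: ereal_sup_ubound; left. Qed.

Lemma le_diam {R : realType} (A B : set (R * R)) : A `<=` B -> (diam A <= diam B)%E.
Proof.
move=> AB; apply: ge_ereal_sup => _ [->|[pq [Ap Aq] <-]]; first exact: diam_ge0.
by apply: ereal_sup_ubound; right; exists pq => //; split; exact: AB.
Qed.

Lemma enorm_le_diam {R : realType} (A : set (R * R)) p q : A p -> A q ->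
  ((enorm (p - q))%:E <= diam A)%E.
Proof. by move=> Ap Aq; apply: ereal_sup_ubound; right; exists (p, q). Qed.

Lemma diam0 {R : realType} : diam (set0 : set (R * R)) = 0%E.
Proof.
apply/eqP; rewrite eq_le diam_ge0 andbT.
by apply: ge_ereal_sup => x [->//|[pq [pq1 _]]]; case: pq1.
Qed.

(** The cones from [c] over the pieces of the cover fill [E] inside the disk, so their areas add up
    to at least that of this part of [E]. [delta] depends only on [eps] and [rho], which lets one
    threshold serve all covers. *)
Lemma area_le_cover {R : realType} (eps rho : R) : 0 < eps -> 0 < rho ->
  exists2 delta : R, 0 < delta &
  forall (E : set (R * R)) (c : R * R) (U : nat -> set (R * R)),
  open E ->
  (forall q, closure E q -> closure (disk c rho) q -> disk c rho q) ->
  boundary E `<=` \bigcup_i U i ->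
  (forall i, (diam (U i) <= delta%:E)%E) ->
  (area (E `&` disk c rho) <=
   ((1 + eps) * rho / 2)%:E * \sum_(0 <= i <oo) diam (U i `&` disk c rho))%E.
Proof.
move=> eps0 rho0; have [delta delta0 cone] := cone_area_le_small eps rho eps0 rho0.
exists delta => // E c U oE EDD EU Udelta.
have Ud i : (diam (U i `&` disk c rho) <= delta%:E)%E.
  by apply: le_trans (Udelta i); apply: le_diam; exact: subIsetl.
have Ufin i : diam (U i `&` disk c rho) \is a fin_num.
  by rewrite ge0_fin_numE ?diam_ge0// (le_lt_trans (Ud i))// ltry.
pose V i := [set p - c | p in U i `&` disk c rho].
have VK i : cone_area_le (V i) ((1 + eps) * rho / 2 * fine (diam (U i `&` disk c rho))).
  apply: cone.
  - by rewrite fine_ge0 ?diam_ge0//= -lee_fin fineK.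
  - by move=> _ [p [_ Dp] <-]; exact: ltW.
  - move=> _ _ [p Vp <-] [q Vq <-].
    by rewrite opprB addrA subrK -lee_fin fineK//; exact: enorm_le_diam.
have [K KP] : exists K : nat -> set (plane R), forall i,
    (measurable (K i) /\ (area (K i) <=
       ((1 + eps) * rho / 2 * fine (diam (U i `&` disk c rho)))%:E)%E) /\
    forall p t, V i p -> 0 <= t <= 1 -> K i (t * p.1, t * p.2).
  have VK' i : exists K : set (plane R), (measurable K /\ (area K <=
       ((1 + eps) * rho / 2 * fine (diam (U i `&` disk c rho)))%:E)%E) /\
    forall p t, V i p -> 0 <= t <= 1 -> K (t * p.1, t * p.2).
    by have [K ? ?] := VK i; exists K.
  by have [K KP] := choice VK'; exists K.
(* The translation taking [c] to the origin, in the form to which [area_affine] applies. *)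
pose f (p : plane R) := (1 * p.1 + - c.1, 1 * p.2 + - c.2) : plane R.
have mf i : measurable (f @^-1` K i).
  by rewrite -[X in measurable X]setTI; apply: measurable_affine_plane => //; exact: (KP i).1.1.
have areaf i : area (f @^-1` K i) = area (K i).
  rewrite -(area_affine 1 1 (- c.1) (- c.2) (K i)) ?oner_eq0//; last exact: (KP i).1.1.
  by rewrite mulr1 normr1 mul1e.
have mE : measurable (E `&` disk c rho : set (plane R)).
  by apply: open_measurable_plane; apply: openI => //; exact: open_disk.
have EK : E `&` disk c rho `<=` \bigcup_i (f @^-1` K i).
  move=> p [Ep Dp].
  have [t [q [t01 bq Dq pE]]] := disk_cone_boundary E c rho oE EDD p Ep Dp.
  have [i _ Ui] := EU _ bq; exists i => //.
  rewrite /= /f pE/= !mul1r !addrK.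
  by apply: ((KP i).2 (q - c) t _ t01); exists q.
apply: (@le_trans _ _ (\sum_(0 <= i <oo) area (f @^-1` K i))%E).
  exact: (measure_sigma_subadditive (lebesgue_measure \x lebesgue_measure)%E).
rewrite -nneseriesZl; last by move=> i _; exact: diam_ge0.
apply: lee_nneseries => [i _ _|i _]; first exact: area_ge0.
by rewrite areaf (le_trans (KP i).1.2)// EFinM fineK.
Qed.

Lemma closed_closed_disk {R : realType} (c : R * R) (rho : R) :
  closed [set p | enorm (p - c) <= rho].
Proof.
apply: (@preimage_closed _ _ (fun p : R * R => enorm (p - c)) [set x | x <= rho]).
  move=> p _; apply: (@cvg_comp _ _ _ (fun q : R * R => q - c) enorm).
    by apply: cvgB; [exact: cvg_id|exact: cvg_cst].
  exact: continuous_enorm.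
exact: closed_le.
Qed.

Lemma closure_disk_le {R : realType} (c : R * R) (rho : R) q :
  closure (disk c rho) q -> enorm (q - c) <= rho.
Proof.
move=> /(@closure_subset _ _ [set p : R * R | enorm (p - c) <= rho]).
by rewrite -(closure_id _).1; [apply => r /ltW|exact: closed_closed_disk].
Qed.

Lemma disks_apart {R : realType} (c1 c2 : R * R) (r1 r2 : R) p q :
  enorm (p - c1) <= r1 -> enorm (q - c2) <= r2 ->
  enorm (c1 - c2) - r1 - r2 <= enorm (p - q).
Proof.
move=> p1 q2.
have -> : c1 - c2 = (c1 - p) + ((p - q) + (q - c2)).
  by rewrite !addrA !subrK.
have := enormD (c1 - p) ((p - q) + (q - c2)).
have := enormD (p - q) (q - c2).
by rewrite (enormB c1); lra.
Qed.

(** This prevents a piece of a fine cover from being counted in both disks when the two length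
    estimates are added. *)
Lemma small_meets_one_disk {R : realType} (U : set (R * R)) (c1 c2 : R * R)
    (r1 r2 : R) : r1 + r2 < enorm (c1 - c2) ->
  (diam U <= ((enorm (c1 - c2) - r1 - r2) / 2)%:E)%E ->
  U `&` disk c1 r1 = set0 \/ U `&` disk c2 r2 = set0.
Proof.
move=> far Ud.
have [[p [Up Dp]]|U1] := pselect (U `&` disk c1 r1 !=set0); last first.
  by left; apply: contra_notP U1 => /eqP/set0P.
right; apply/eqP/negPn/negP => /set0P[q [Uq Dq]].
have := disks_apart _ _ _ _ _ _ (ltW Dp) (ltW Dq).
have := le_trans (enorm_le_diam _ _ _ Up Uq) Ud; rewrite lee_fin => {Ud Up Uq Dp Dq}.
by lra.
Qed.

Lemma area_disk_part {R : realType} (E : set (R * R)) (c : R * R) (rho : R) :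
  open E -> 0 < rho ->
  (area (E `&` disk c rho) <= (disk_const R * rho ^+ 2)%:E)%E.
Proof.
move=> oE rho0; rewrite -(area_disk c)//; apply: le_area.
- by apply: open_measurable_plane; apply: openI => //; exact: open_disk.
- exact: measurable_disk.
- exact: subIsetr.
Qed.

Lemma area_disk_part_fin_num {R : realType} (E : set (R * R)) (c : R * R) (rho : R) :
  open E -> 0 < rho -> area (E `&` disk c rho) \is a fin_num.
Proof.
move=> oE rho0; rewrite ge0_fin_numE ?area_ge0//.
by rewrite (le_lt_trans (area_disk_part _ c _ oE rho0))// ltry.
Qed.

Lemma hausdorff1_boundary_ge {R : realType} (E : set (R * R)) (c1 c2 : R * R) (r1 r2 : R) :
  0 < r1 -> 0 < r2 -> r1 + r2 < enorm (c1 - c2) -> open E ->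
  closure E `<=` disk c1 r1 `|` disk c2 r2 ->
  ((2 / r1 * fine (area (E `&` disk c1 r1)) +
    2 / r2 * fine (area (E `&` disk c2 r2)))%:E <= hausdorff1 (boundary E))%E.
Proof.
move=> r10 r20 far oE EO.
set a1 := fine _; set a2 := fine _.
have a10 : 0 <= a1 by rewrite fine_ge0// area_ge0.
have a20 : 0 <= a2 by rewrite fine_ge0// area_ge0.
have far21 : r2 + r1 < enorm (c2 - c1) by rewrite enormB addrC.
(* A point of the closed disk cannot lie in the other disk, so a point of [closure E] there lies in
   the open disk. The statement is generic so as to serve both disks. *)
have EDD d1 d2 s1 s2 : s1 + s2 < enorm (d1 - d2) ->
    closure E `<=` disk d1 s1 `|` disk d2 s2 ->
    forall q, closure E q -> closure (disk d1 s1) q -> disk d1 s1 q.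
  move=> dfar EO' q /EO' [//|q2] /closure_disk_le q1.
  have := disks_apart _ _ _ _ _ _ q1 (ltW q2).
  by rewrite subrr enorm0; lra.
have EO' : closure E `<=` disk c2 r2 `|` disk c1 r1 by rewrite setUC.
suff He (e : R) : 0 < e -> (((2 / r1 * a1 + 2 / r2 * a2) / (1 + e))%:E <=
    hausdorff1 (boundary E))%E.
  move: He; case: (hausdorff1 (boundary E)) => [h||] He.
  - rewrite lee_fin leNgt; apply/negP => hx; set x := (X in h < X) in hx.
    have h0 : 0 <= h.
      have := He 1 ltr01; rewrite lee_fin; apply: le_trans.
      by rewrite divr_ge0// addr_ge0// mulr_ge0// divr_ge0// ltW.
    (* With this [e] one has [e * h < x - h], which contradicts [x <= h * (1 + e)]. *)
    have e0 : 0 < (x - h) / (2 * (h + 1)) by rewrite divr_gt0//; lra.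
    have := He _ e0; rewrite lee_fin -/x ler_pdivrMr; last by lra.
    set e := _ / _ in e0 *.
    have : e * (2 * (h + 1)) = x - h by rewrite divfK// gt_eqF//; lra.
    by nra.
  - exact: leey.
  - by have := He 1 ltr01; rewrite leeNy_eq.
move=> e0.
have [d1 d10 cov1] := area_le_cover e r1 e0 r10.
have [d2 d20 cov2] := area_le_cover e r2 e0 r20.
pose gap := (enorm (c1 - c2) - r1 - r2) / 2.
(* Fine enough for the cone estimate in each disk and for no piece to meet both. *)
pose d := Num.min gap (Num.min d1 d2).
have gap0 : 0 < gap by rewrite divr_gt0//; lra.
have d0 : 0 < d by rewrite !lt_min gap0 d10.
have dgap : d <= gap by rewrite ge_min lexx.
have dd1 : d <= d1 by rewrite 2!ge_min lexx !orbT.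
have dd2 : d <= d2 by rewrite 2!ge_min lexx !orbT.
apply: (@le_trans _ _ (hausdorff1_pre d (boundary E))); last first.
  by apply: ereal_sup_ubound; exists d.
apply: le_ereal_inf_tmp => _ [U [EU Ud] <-].
have Udd i dd : d <= dd -> (diam (U i) <= dd%:E)%E.
  by move=> ddd; apply: le_trans (Ud i) _; rewrite lee_fin.
have half (k x : R) (y : \bar R) : 0 < k ->
    (x%:E <= ((1 + e) * k / 2)%:E * y)%E -> ((2 / k * x / (1 + e))%:E <= y)%E.
  move=> k0; rewrite -lee_pdivrMl; last by rewrite divr_gt0// mulr_gt0//; lra.
  rewrite -EFinM; apply: le_trans; rewrite lee_fin le_eqVlt; apply/orP; left; apply/eqP.
  by field; rewrite !gt_eqF//; lra.
have := cov2 E c2 U oE (EDD _ _ _ _ far21 EO') EU (fun i => Udd i d2 dd2).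
rewrite -[area _]fineK; last exact: area_disk_part_fin_num.
move=> /(half _ _ _ r20) S2.
have := cov1 E c1 U oE (EDD _ _ _ _ far EO) EU (fun i => Udd i d1 dd1).
rewrite -[area _]fineK; last exact: area_disk_part_fin_num.
move=> /(half _ _ _ r10) S1.
rewrite mulrDl EFinD; apply: (le_trans (leeD S1 S2)).
rewrite -nneseriesD; [|by move=> *; exact: diam_ge0..].
apply: lee_nneseries => [i _ _|i _]; first by rewrite adde_ge0 ?diam_ge0.
have [->|->] := small_meets_one_disk (U i) _ _ _ _ far (Udd i gap dgap).
  by rewrite diam0 add0e le_diam//; exact: subIsetl.
by rewrite diam0 adde0 le_diam//; exact: subIsetl.
Qed.

(** * Lower bound for the Cheeger constant *)

Lemma area_open_gt0 {R : realType} (E : set (R * R)) : open E -> E !=set0 ->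
  (0 < area E)%E.
Proof.
move=> oE [p Ep].
have /nbhs_ballP[e/= e0 peE] : nbhs p E by exact: open_nbhs_nbhs.
apply: (@lt_le_trans _ _ (area (`[p.1, p.1 + e / 2]%classic `*`
    `[p.2, p.2 + e / 2]%classic))).
  rewrite area_box ?lerDl ?divr_ge0 ?ltW//.
  by rewrite lte_fin (addrAC p.1) (addrAC p.2) !subrr !add0r mulr_gt0// divr_gt0.
apply: le_area; [exact: measurableX|exact: open_measurable_plane|].
move=> q [] /=; rewrite !in_itv/= => /andP[q1 q2] /andP[q3 q4].
by apply: peE; split; rewrite /ball/= ltr_norml; apply/andP; split; lra.
Qed.

Lemma cheeger_const_disks_ge {R : realType} (c1 c2 : R * R) (r1 r2 : R) :
  0 < r1 -> 0 < r2 -> r1 + r2 < enorm (c1 - c2) ->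
  r1 * (2 * r2 ^+ 2 + r1 ^+ 2) <= r2 ^+ 3 ->
  ((2 / (disk_const R * r2 ^+ 3))%:E <=
   cheeger_const 2^-1 (disk c1 r1 `|` disk c2 r2))%E.
Proof.
move=> r10 r20 far ratio.
apply: le_ereal_inf_tmp => _ [E [E0 oE _ [_ clE]] <-].
have EO : E `<=` disk c1 r1 `|` disk c2 r2.
  by move=> p Ep; apply: clE; exact: subset_closure.
have := hausdorff1_boundary_ge E _ _ _ _ r10 r20 far oE clE.
have := area_disk_part E c1 r1 oE r10; have := area_disk_part E c2 r2 oE r20.
have := area_disk_part_fin_num E c1 r1 oE r10.
have := area_disk_part_fin_num E c2 r2 oE r20.
have areaE : area E = (area (E `&` disk c1 r1) + area (E `&` disk c2 r2))%E.
  rewrite -[in LHS](setIidl EO) setIUr.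
  apply: (measureU (lebesgue_measure \x lebesgue_measure)%E).
  - by apply: open_measurable_plane; apply: openI => //; exact: open_disk.
  - by apply: open_measurable_plane; apply: openI => //; exact: open_disk.
  - apply/seteqP; split=> // p [[_ p1] [_ p2]].
    have := disks_apart _ _ _ _ _ _ (ltW p1) (ltW p2).
    by rewrite subrr enorm0; lra.
have := area_open_gt0 E oE E0; rewrite areaE.
have : 0 <= fine (area (E `&` disk c1 r1)) by rewrite fine_ge0// area_ge0.
have : 0 <= fine (area (E `&` disk c2 r2)) by rewrite fine_ge0// area_ge0.
case: (area (E `&` disk c1 r1)) => // a1; case: (area (E `&` disk c2 r2)) => // a2.
rewrite -EFinD lte_fin !lee_fin /= => a20 a10 a12 _ _ a2R a1r H1.
(* For [q = 1/2] the area enters squared; as it is positive, the extended inverse is the ordinary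
   one. *)
rewrite invrK (powR_mulrn 2 (ltW a12)) inver gt_eqF ?exprn_gt0//=.
rewrite lee_pdivlMr ?exprn_gt0//; apply: le_trans H1; rewrite -EFinM lee_fin.
have := @disk_const_gt0 R; set k := disk_const R in a2R a1r *; move=> k0.
have r23 : 0 < k * r2 ^+ 3 by rewrite mulr_gt0// exprn_gt0.
rewrite mulrAC ler_pdivrMr//.
suff main : (a1 + a2) ^+ 2 <= (a1 / r1 + a2 / r2) * (k * r2 ^+ 3).
  apply: le_trans (_ : 2 * ((a1 / r1 + a2 / r2) * (k * r2 ^+ 3)) <= _).
    by rewrite ler_wpM2l.
  by rewrite le_eqVlt; apply/orP; left; apply/eqP; field; rewrite !gt_eqF.
(* The square of [a1 + a2] is split so that each part is absorbed by one disk. This part uses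
   [a1 <= k * r1 ^+ 2], [a2 <= k * r2 ^+ 2] and the relation between the radii; the other one only
   [a2 <= k * r2 ^+ 2]. *)
have e1 : a1 * (2 * a2 + a1) <= a1 / r1 * (k * r2 ^+ 3).
  rewrite mulrAC ler_pdivlMr//.
  rewrite -mulrA; apply: ler_wpM2l => //.
  apply: (@le_trans _ _ (k * (r1 * (2 * r2 ^+ 2 + r1 ^+ 2)))).
    by rewrite (mulrCA k) (mulrC _ r1) ler_pM2l// mulrDr mulrCA lerD// ler_pM2l.
  by rewrite ler_pM2l.
have e2 : a2 * a2 <= a2 / r2 * (k * r2 ^+ 3).
  rewrite (_ : _ / _ * _ = a2 * (k * r2 ^+ 2)); first by rewrite ler_wpM2l.
  by field; rewrite gt_eqF.
have -> : (a1 + a2) ^+ 2 = a1 * (2 * a2 + a1) + a2 * a2 by ring.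
by rewrite [leRHS]mulrDl; apply: lerD.
Qed.

(** Since the square root of 7 is below 3, the ratio is below 1/3; the other factor is at most
    [3 * r2 ^+ 2]. *)
Lemma radii_ratio {R : realType} (r1 r2 : R) : 0 < r1 -> 0 < r2 ->
  r1 / r2 < (Num.sqrt 7 - 2) / 3 -> r1 * (2 * r2 ^+ 2 + r1 ^+ 2) <= r2 ^+ 3.
Proof.
move=> r10 r20 ratio.
have sqrt7 : Num.sqrt 7 < 3 :> R.
  rewrite -(@ltr_pXn2r _ 2) ?nnegrE ?sqrtr_ge0// sqr_sqrtr//.
  by rewrite expr2; lra.
have lt3 : r1 < r2 / 3 by rewrite -ltr_pdivrMl// mulrC; lra.
have h2 : 0 <= r2 ^+ 2 by rewrite exprn_ge0// ltW.
have h1 : r1 ^+ 2 <= r2 ^+ 2 by rewrite ler_pXn2r// ?nnegrE; lra.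
apply: (@le_trans _ _ (r2 / 3 * (3 * r2 ^+ 2))).
  by apply: ler_pM; [exact: ltW|rewrite addr_ge0 ?mulr_ge0 ?exprn_ge0// ltW|exact: ltW|lra].
by rewrite le_eqVlt; apply/orP; left; apply/eqP; field.
Qed.

(** * Smooth bumps *)

(* The span of this family, for fixed [eta], is closed under differentiation. *)
Definition flat {R : realType} (eta : R) (k : nat) (t : R) : R :=
  if 0 < t then t^-1 ^+ k * expR (- (eta * t^-1)) else 0.

Lemma flat_ge0 {R : realType} (eta : R) k t : 0 <= flat eta k t.
Proof.
by rewrite /flat; case: ifPn => // t0; rewrite mulr_ge0 ?expR_ge0// exprn_ge0// invr_ge0 ltW.
Qed.

Lemma flat_le0 {R : realType} (eta : R) k t : t <= 0 -> flat eta k t = 0.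
Proof. by rewrite /flat ltNge => ->. Qed.

(** Write [expR x] as the power [n.+1] of [expR (x / n.+1%:R)] and use [1 + y <= expR y]. *)
Lemma expR_ge_pow {R : realType} (n : nat) (x : R) : 0 <= x ->
  (x / n.+1%:R) ^+ n.+1 <= expR x.
Proof.
move=> x0; rewrite -[in leRHS](@divfK _ n.+1%:R _ x) ?pnatr_eq0// expRM_natr.
rewrite ler_pXn2r ?nnegrE ?divr_ge0 ?expR_ge0//.
by rewrite (le_trans _ (expR_ge1Dx _))// lerDr.
Qed.

(** A quadratic bound at 0 is what makes the derivative there vanish. It follows from [expR_ge_pow]
    with exponent [k.+2]: [k] factors cancel the pole and two remain. *)
Lemma flat_le_sqr {R : realType} (eta : R) k : 0 < eta ->
  exists2 C : R, 0 <= C & forall t, flat eta k t <= C * t ^+ 2.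
Proof.
move=> eta0; exists ((k.+2%:R / eta) ^+ k.+2).
  by rewrite exprn_ge0// divr_ge0// ltW.
move=> t; rewrite /flat; case: ifPn => t0; last first.
  by rewrite mulr_ge0 ?sqr_ge0// exprn_ge0// divr_ge0// ltW.
have x0 : 0 < eta * t^-1 by rewrite mulr_gt0// invr_gt0.
have y0 : 0 < (eta * t^-1 / k.+2%:R) ^+ k.+2 by rewrite exprn_gt0// divr_gt0.
have : expR (- (eta * t^-1)) <= ((eta * t^-1 / k.+2%:R) ^+ k.+2)^-1.
  by rewrite expRN lef_pV2 ?posrE ?expR_gt0// expR_ge_pow// ltW.
move=> /(ler_wpM2l (exprn_ge0 k (ltW (_ : 0 < t^-1)))); rewrite invr_gt0 => /(_ t0).
move=> /le_trans; apply; rewrite le_eqVlt; apply/orP; left; apply/eqP.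
have -> : (eta * t^-1 / k.+2%:R) ^+ k.+2 = (k.+2%:R / eta) ^- k.+2 * t^-1 ^+ k * t ^- 2.
  rewrite -!exprVn -[RHS]mulrA -exprD addn2 -exprMn invf_div; congr (_ ^+ _); ring.
by field; rewrite !gt_eqF// ?exprn_gt0// ?divr_gt0// invr_gt0.
Qed.

(** Away from 0 this is the chain rule through [t^-1], or the derivative of a constant; at 0 the
    difference quotient is bounded by a multiple of [h]. *)
Lemma is_derive_flat {R : realType} (eta : R) (k : nat) (t : R) : 0 < eta ->
  is_derive t 1 (flat eta k)
    (eta * flat eta k.+2 t - k%:R * flat eta k.+1 t).
Proof.
move=> eta0; have [t_lt0|t_gt0|->] := ltgtP t 0.
- rewrite !flat_le0 ?ltW// !mulr0 subrr.
  apply: (@near_eq_is_derive _ _ _ (cst 0)).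
  near=> x; rewrite /= flat_le0// ltW//; near: x.
  exact: lt_nbhsl.
- pose P (y : R) := y ^+ k * expR (- (eta * y)).
  apply: (@near_eq_is_derive _ _ _ (P \o (fun x => x^-1))).
    near=> x; rewrite /P /= /flat ifT//; near: x.
    exact: lt_nbhsr.
  rewrite /flat t_gt0.
  have dV : is_derive t 1 (fun x : R => x^-1) (- t ^- 2).
    have := @is_deriveV _ id t 1 1 (lt0r_neq0 t_gt0) (is_derive_id _ _).
    by rewrite /GRing.scale/= mulr1.
  have dE (y : R) : is_derive y 1 (fun y => expR (- (eta * y))) (expR (- (eta * y)) * - eta).
    apply: (@is_derive1_comp _ expR (fun y => - (eta * y))).
    by apply: is_derive_eq; rewrite /GRing.scale/= mulr1.
  have dP (y : R) : is_derive y 1 P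
      (y ^+ k * (expR (- (eta * y)) * - eta) +
       expR (- (eta * y)) * (k%:R * y ^+ k.-1)).
    have := is_deriveM (is_deriveX k (is_derive_id y 1)) (dE y).
    by rewrite !fctE /GRing.scale/= !mulr1.
  have := is_derive1_comp (dP t^-1) dV.
  rewrite (_ : _ * _ = eta * (t^-1 ^+ k.+2 * expR (- (eta * t^-1))) -
     k%:R * (t^-1 ^+ k.+1 * expR (- (eta * t^-1)))) // -exprVn.
  by case: k {P dP} => [|k] /=; rewrite !exprS; ring.
- rewrite !flat_le0// !mulr0 subrr.
  have [C C0 flatC] := flat_le_sqr eta k eta0.
  have C1 : 0 < C + 1 by lra.
  have lim0 : (fun h : R => h^-1 *: (flat eta k (h *: 1 + 0) - flat eta k 0)) @ 0^' --> 0.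
    apply/cvgr0Pnorm_le => e e0; near=> h.
    rewrite addr0 (flat_le0 _ _ 0)// subr0 /GRing.scale/= mulr1.
    have h0 : h != 0 by near: h; exact: nbhs_dnbhs_neq.
    rewrite normrM (ger0_norm (flat_ge0 _ _ _)) normfV mulrC ler_pdivrMr ?normr_gt0//.
    apply: le_trans (flatC h) _; rewrite -[h ^+ 2]real_normK ?num_real// expr2 mulrA.
    rewrite ler_wpM2r//.
    apply: (@le_trans _ _ ((C + 1) * `|h|)); first by rewrite ler_wpM2r// lerDl.
    rewrite -ler_pdivlMl//; near: h; apply: dnbhs0_le.
    by rewrite mulr_gt0// invr_gt0.
  by split; [apply/cvg_ex; exists 0|exact/cvg_lim].
Unshelve. all: by end_near. Qed.

Definition flat_bump {R : realType} (eta : R) (k : nat) (c : R * R) (s : R)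
  (p : R * R) : R := flat eta k (s - ((p.1 - c.1) ^+ 2 + (p.2 - c.2) ^+ 2)).

(** The algebra generated by polynomials and flat bumps. It consists of continuous functions and is
    stable under partial derivatives, so smoothness to all orders needs no explicit higher
    derivative. *)
Inductive elementary {R : realType} (eta : R) : (R * R -> R) -> Prop :=
| elementary_cst a : elementary eta (fun=> a)
| elementary_fst : elementary eta (fun p => p.1)
| elementary_snd : elementary eta (fun p => p.2)
| elementaryD f g : elementary eta f -> elementary eta g ->
    elementary eta (fun p => f p + g p)
| elementaryM f g : elementary eta f -> elementary eta g ->
    elementary eta (fun p => f p * g p)
| elementary_flat_bump k c s : elementary eta (flat_bump eta k c s).

(** Reduces directional derivatives to the calculus of one variable. *)
Lemma is_derive_line {R : realType} (f : R * R -> R) (p v : R * R) (df : R) :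
  is_derive p v f df <-> is_derive (0 : R) 1 (fun h => f (h *: v + p)) df.
Proof.
have E : (fun h : R => h^-1 *: ((fun h => f (h *: v + p)) (h *: 1 + 0) -
      (fun h => f (h *: v + p)) 0)) =
    (fun h : R => h^-1 *: (f (h *: v + p) - f p)).
  by apply/funext => h; rewrite scale0r add0r addr0 /GRing.scale/= mulr1.
split=> -[df1 df2]; split.
- by move: df1; rewrite /derivable/= E.
- by move: df2; rewrite /derive/= E.
- by move: df1; rewrite /derivable/= E.
- by move: df2; rewrite /derive/= E.
Qed.

Lemma is_derive_comp_plane {R : realType} (g : R -> R) (f : R * R -> R)
    (p v : R * R) (df dg : R) :
  is_derive p v f df -> is_derive (f p) 1 g dg ->
  is_derive p v (g \o f) (dg * df).
Proof.
move=> /is_derive_line f' g'; apply/is_derive_line.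
apply: (@is_derive1_comp _ g (fun h => f (h *: v + p))).
by rewrite scale0r add0r.
Qed.

Lemma is_derive_fst {R : realType} (p v : R * R) : is_derive p v (fun p => p.1) v.1.
Proof.
apply/is_derive_line => /=; apply: is_derive_eq.
by rewrite /GRing.scale/= mulr0 add0r mulr1 addr0.
Qed.

Lemma is_derive_snd {R : realType} (p v : R * R) : is_derive p v (fun p => p.2) v.2.
Proof.
apply/is_derive_line => /=; apply: is_derive_eq.
by rewrite /GRing.scale/= mulr0 add0r mulr1 addr0.
Qed.

Lemma is_derive_flat_bump {R : realType} (eta : R) k c s (p v : R * R) : 0 < eta ->
  is_derive p v (flat_bump eta k c s)
   ((eta * flat_bump eta k.+2 c s p - k%:R * flat_bump eta k.+1 c s p) *
    (-2 * ((p.1 - c.1) * v.1 + (p.2 - c.2) * v.2))).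
Proof.
move=> eta0.
apply: (@is_derive_comp_plane R (flat eta k)
   (fun p => s - ((p.1 - c.1) ^+ 2 + (p.2 - c.2) ^+ 2))).
  apply/is_derive_line => /=; apply: is_derive_eq.
  rewrite /GRing.scale/=.
  ring.
exact: is_derive_flat.
Qed.

Lemma continuous_flat {R : realType} (eta : R) k : 0 < eta -> continuous (flat eta k).
Proof.
move=> eta0 t; apply/differentiable_continuous/derivable1_diffP.
exact: (@ex_derive _ _ _ _ _ _ _ (is_derive_flat eta k t eta0)).
Qed.

Lemma elementary_continuous {R : realType} (eta : R) f : 0 < eta ->
  elementary eta f -> continuous f.
Proof.
move=> eta0; elim=> {f} [a|||f g _ cf _ cg|f g _ cf _ cg|k c s] p.
- exact: cvg_cst.
- exact: cvg_fst.
- exact: cvg_snd.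
- by apply: cvgD; [exact: cf|exact: cg].
- by apply: cvgM; [exact: cf|exact: cg].
- apply: (@cvg_comp _ _ _ (fun p : R * R => s - ((p.1 - c.1) ^+ 2 + (p.2 - c.2) ^+ 2))
      (flat eta k)); last exact: continuous_flat.
  apply: cvgB; first exact: cvg_cst.
  apply: cvgD; apply: (@cvg_comp _ _ _ _ (fun x : R => x ^+ 2)
    _ _ _ _ (@exprn_continuous _ 2 _)); apply: cvgB;
    (exact: cvg_fst || exact: cvg_snd || exact: cvg_cst).
Qed.

Lemma elementary_derive {R : realType} (eta : R) f (v : R * R) : 0 < eta ->
  elementary eta f ->
  exists2 g, elementary eta g & forall p, is_derive p v f (g p).
Proof.
move=> eta0; elim=> {f} [a|||f g ef [f' ef' df] eg [g' eg' dg]|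
    f g ef [f' ef' df] eg [g' eg' dg]|k c s].
- by exists (fun=> 0) => [|p]; [exact: elementary_cst|exact: is_derive_cst].
- by exists (fun=> v.1) => [|p]; [exact: elementary_cst|exact: is_derive_fst].
- by exists (fun=> v.2) => [|p]; [exact: elementary_cst|exact: is_derive_snd].
- by exists (fun p => f' p + g' p) => [|p]; [exact: elementaryD|exact: is_deriveD].
- exists (fun p => f p * g' p + g p * f' p) => [|p]; last exact: is_deriveM.
  by apply: elementaryD; exact: elementaryM.
- exists (fun p => (eta * flat_bump eta k.+2 c s p +
      (- k%:R) * flat_bump eta k.+1 c s p) *
      (-2 * ((p.1 + - c.1) * v.1 + (p.2 + - c.2) * v.2))) => [|p]; last first.
    by rewrite mulNr; exact: is_derive_flat_bump.
  do ?[exact: elementary_cst|exact: elementary_fst|exact: elementary_snd|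
       exact: elementary_flat_bump|apply: elementaryM|apply: elementaryD].
Qed.

Lemma elementary_partial {R : realType} (eta : R) b f : 0 < eta ->
  elementary eta f -> elementary eta (partial b f).
Proof.
move=> eta0 /(elementary_derive eta _ (axis b) eta0)[g eg dg].
suff -> : partial b f = g by [].
by apply/funext => p; rewrite /partial derive_val.
Qed.

Lemma elementary_smooth {R : realType} (eta : R) f : 0 < eta ->
  elementary eta f -> smooth_plane f.
Proof.
move=> eta0 ef s.
have es : elementary eta (foldr partial f s).
  by elim: s => //= b s; exact: elementary_partial.
split; first exact: elementary_continuous eta0 es.
move=> b p; have [g _ dg] := elementary_derive eta _ (axis b) eta0 es.
exact: (@ex_derive _ _ _ _ _ _ _ (dg p)).
Qed.

(** * Integrals of radial functions *)

Definition sqr_dist {R : realType} (c p : R * R) : R :=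
  (p.1 - c.1) ^+ 2 + (p.2 - c.2) ^+ 2.

Lemma sqr_dist_ge0 {R : realType} (c p : R * R) : 0 <= sqr_dist c p.
Proof. by rewrite addr_ge0 ?sqr_ge0. Qed.

Lemma measurable_sqr_dist {R : realType} (c : R * R) :
  measurable_fun setT (sqr_dist c : plane R -> measurableTypeR R).
Proof.
by apply: measurable_funD; apply: measurable_funX; apply: measurable_funB.
Qed.

Lemma measurable_sqr_dist_le {R : realType} (c : R * R) (s : R) :
  measurable ([set p | sqr_dist c p <= s] : set (plane R)).
Proof.
rewrite (_ : [set p | _] = sqr_dist c @^-1` `]-oo, s]%classic); last first.
  by apply/seteqP; split=> p /=; rewrite in_itv.
by rewrite -[X in measurable X]setTI; exact: measurable_sqr_dist.
Qed.

Lemma disk_sqr_dist {R : realType} (c : R * R) (s : R) : 0 < s ->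
  disk c (Num.sqrt s) = [set p | sqr_dist c p < s].
Proof.
by move=> s0; apply/seteqP; split=> p;
  rewrite /disk/= enorm_lt ?sqrtr_gt0// sqr_sqrtr// ltW.
Qed.

Lemma area_sqr_dist_le {R : realType} (c : R * R) (s : R) :
  area [set p | sqr_dist c p <= s] = (disk_const R * Num.max s 0)%:E.
Proof.
have k0 := @disk_const_gt0 R.
have [s0|s0] := ltP s 0.
  rewrite mulr0 (_ : [set p | _] = set0) ?area0//.
  by apply/seteqP; split=> // p /=; rewrite leNgt (lt_le_trans s0)// sqr_dist_ge0.
(* The closed disk is squeezed between the open disk of squared radius [s] and slightly larger open
   disks, of squared radius [s + e / disk_const R] and so of area larger by [e]. *)
apply/eqP; rewrite eq_le; apply/andP; split.
  apply/lee_addgt0Pr => e e0.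
  have d0 : 0 < s + e / disk_const R by rewrite ltr_wpDl// divr_gt0.
  apply: (@le_trans _ _ (area (disk c (Num.sqrt (s + e / disk_const R))))).
    apply: le_area; [exact: measurable_sqr_dist_le|exact: measurable_disk|].
    move=> p /= ps; rewrite disk_sqr_dist//= (le_lt_trans ps)// ltrDl divr_gt0//.
  rewrite area_disk ?sqrtr_gt0// sqr_sqrtr ?(ltW d0)// -EFinD lee_fin.
  by rewrite mulrDr mulrCA divff ?mulr1// gt_eqF.
have : (0 == s) || (0 < s) by rewrite -le_eqVlt.
move=> /predU1P[<-|{}s0]; first by rewrite mulr0 area_ge0.
rewrite -[X in (_ * X)%:E](@sqr_sqrtr _ s) ?(ltW s0)// -(area_disk c) ?sqrtr_gt0//.
apply: le_area; [exact: measurable_disk|exact: measurable_sqr_dist_le|].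
by move=> p; rewrite disk_sqr_dist//= => /ltW.
Qed.

Lemma area_sqr_dist_itv {R : realType} (c : R * R) (a b : R) : a <= b ->
  area (sqr_dist c @^-1` `]a, b]%classic) =
  (disk_const R * (Num.max b 0 - Num.max a 0))%:E.
Proof.
move=> ab.
rewrite (_ : _ @^-1` _ = [set p | sqr_dist c p <= b] `\` [set p | sqr_dist c p <= a]); last first.
  apply/seteqP; split=> p /=; rewrite in_itv/= ltNge.
    by move=> /andP[/negP].
  by move=> [-> /negP ->].
rewrite /area measureD.
- rewrite (_ : _ `&` _ = [set p | sqr_dist c p <= a]); last first.
    by apply/seteqP; split=> p /= => [[]//|pa]; split=> //; exact: le_trans ab.
  rewrite -[X in (X - _)%E]/(area _) -[X in (_ - X)%E]/(area _).
  by rewrite !area_sqr_dist_le -EFinB -mulrBr.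
- exact: measurable_sqr_dist_le.
- exact: measurable_sqr_dist_le.
- by rewrite -[X in (X < _)%E]/(area _) area_sqr_dist_le ltry.
Qed.

Lemma itv_split0 {R : realType} (a b : R) : a <= b ->
  ((Num.max b 0 - Num.max a 0)%:E +
   lebesgue_measure `]a, (Num.min b 0)%R]%classic = (b - a)%:E)%E.
Proof.
move=> ab; rewrite lebesgue_measure_itv/= lte_fin.
have eqD (x y z : R) : (x + y)%R = z -> (x%:E + y%:E)%E = z%:E by move=> <-.
have eq0 (x z : R) : x = z -> (x%:E + 0%:E)%E = z%:E by move=> ->; rewrite adde0.
rewrite lt_min; case: (ltP a 0) => a0; case: (leP b 0) => b0; rewrite ?andbT ?andbF.
- by case: ltP => ab'; [rewrite -EFinB; apply: eqD; lra|apply: eq0; lra].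
- by rewrite (lt_trans a0 b0) -EFinB; apply: eqD; lra.
- by apply: eq0; lra.
- by apply: eq0; lra.
Qed.

(** The disk of squared radius [s] has area proportional to [s], so the squared distance pushes area
    forward to a multiple of Lebesgue measure on the half-line. *)
Lemma area_sqr_dist_preimage {R : realType} (c : R * R) (A : set (measurableTypeR R)) :
  measurable A -> A `<=` `[0, +oo[%classic ->
  area (sqr_dist c @^-1` A) = ((disk_const R)%:E * lebesgue_measure A)%E.
Proof.
move=> mA A0; have k0 := @disk_const_gt0 R.
have k0' : 0 <= (disk_const R)^-1 by rewrite invr_ge0 ltW.
pose neg : set (measurableTypeR R) := `]-oo, 0]%classic.
have mneg : measurable neg by exact: measurable_itv.
(* Uniqueness of Lebesgue measure concerns the whole line, while the pushforward charges only the
   half-line; Lebesgue measure on the negative side is added to complete it. *)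
pose nu := measure_add (mscale (NngNum k0')
   (pushforward_measure
      (lebesgue_measure \x lebesgue_measure)%E (measurable_sqr_dist c)))
   (mrestr lebesgue_measure mneg).
have nuE X : nu X = ((disk_const R)^-1%:E * area (sqr_dist c @^-1` X) +
    lebesgue_measure (X `&` neg))%E by rewrite /nu measure_addE.
have leb0 : lebesgue_measure (A `&` neg) = 0%E.
  apply/eqP; rewrite eq_le measure_ge0 andbT -(lebesgue_measure_set1 (0 : R)).
  apply: le_measure; rewrite ?inE//; first exact: measurableI.
  move=> x [/A0]; rewrite /neg /= !in_itv/= andbT => x0 x0'.
  by apply/le_anti/andP.
have -> : lebesgue_measure A = nu A.
  apply: lebesgue_measure_unique => // _ [[a b] _ <-] /=.
  rewrite -[RHS]/(nu `]a, b]%classic) nuE; have [ab|ba] := leP a b; last first.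
    rewrite set_itv_ge ?bnd_simp -?leNgt ?ltW//.
    by rewrite preimage_set0 area0 set0I !measure0 mule0 adde0.
  rewrite area_sqr_dist_itv// -EFinM mulKf ?gt_eqF//.
  have -> : `]a, b]%classic `&` neg = `]a, Num.min b 0]%classic.
    apply/seteqP; split=> x /=; rewrite /neg/= !in_itv/= le_min.
      by move=> [/andP[-> ->] ->].
    by move=> /and3P[-> -> ->].
  rewrite itv_split0// lebesgue_measure_itv/= lte_fin -EFinB.
  by case: ltP => // ba; congr EFin; apply/esym/eqP; rewrite subr_eq0 eq_le ab ba.
rewrite nuE leb0 adde0 muleA -EFinM divff ?mul1e// ?gt_eqF//.
Qed.

Lemma continuous_measurable_plane {R : realType} (f : R * R -> R) : continuous f ->
  measurable_fun setT (f : plane R -> measurableTypeR R).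
Proof.
move=> cf; apply: (measurability _ (RGenOInfty.measurableE R)) => //.
move=> /= _ [_ [a ->] <-]; rewrite setTI; apply: open_measurable_plane.
rewrite (_ : f @^-1` _ = f @^-1` [set x | a < x]); last first.
  by apply/seteqP; split=> p /=; rewrite in_itv/= andbT.
by apply: open_comp; [move=> p _; exact: cf|exact: open_gt].
Qed.

Lemma elementary_measurable {R : realType} (eta : R) f : 0 < eta ->
  elementary eta f -> measurable_fun setT (f : plane R -> measurableTypeR R).
Proof.
by move=> eta0 /elementary_continuous cf; apply: continuous_measurable_plane; exact: cf.
Qed.

(** In the variable [y], the squared distance to [c], the integrand is the derivative of
    [- flat eta 0 (s - y)]. The integral over the plane is thus [disk_const R * flat eta 0 s], and
    [flat eta 0] is at most 1. *)
Lemma integral_flat_bump_le {R : realType} (eta s : R) (c : R * R) (D : set (plane R)) :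
  0 < eta -> 0 < s -> measurable D ->
  (integral_plane D (fun p => (eta * flat_bump eta 2 c s p)%R) <= (disk_const R)%:E)%E.
Proof.
move=> eta0 s0 mD; have k0 := @disk_const_gt0 R.
pose g (y : R) := eta * flat eta 2 (s - y).
have g0 y : 0 <= g y by rewrite mulr_ge0 ?flat_ge0// ltW.
have cg : continuous g.
  move=> y; apply: cvgM; first exact: cvg_cst.
  apply: (@cvg_comp _ _ _ (fun y => s - y) (flat eta 2)); last exact: continuous_flat.
  by apply: cvgB; [exact: cvg_cst|exact: cvg_id].
have mg : measurable_fun setT (EFin \o g : measurableTypeR R -> \bar R).
  by apply/measurable_EFinP; exact: continuous_measurable_fun.
rewrite /integral_plane.
have -> : (fun p => (eta * flat_bump eta 2 c s p)%:E) =
    (EFin \o g) \o (sqr_dist c : plane R -> measurableTypeR R) by [].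
apply: (@le_trans _ _ (\int[lebesgue_measure \x lebesgue_measure]_p
    ((EFin \o g) \o (sqr_dist c : plane R -> measurableTypeR R)) p)%E).
  apply: ge0_subset_integral => //.
  - exact: (measurableT_comp mg (measurable_sqr_dist c)).
  - by move=> p _; rewrite /= lee_fin.
rewrite (_ : (\int[_]_p _ p)%E =
  (\int[lebesgue_measure \x lebesgue_measure]_(p in sqr_dist c @^-1` `[0%R, s])
    ((EFin \o g) \o (sqr_dist c : plane R -> measurableTypeR R)) p)%E); last first.
  rewrite [RHS]integral_mkcond; apply: eq_integral => p _; rewrite patchE.
  case: ifPn => // /negP; rewrite inE /= in_itv/= sqr_dist_ge0/= => /negP.
  by rewrite -ltNge /g => ps; rewrite flat_le0 ?mulr0// subr_le0 ltW.
rewrite -(ge0_integral_pushforward (measurable_sqr_dist c))//; last 2 first.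
- exact: measurable_funTS.
- by move=> y _; rewrite lee_fin.
rewrite (@eq_measure_integral _ _ _ _ (mscale (NngNum (ltW k0)) lebesgue_measure)
  (pushforward_measure
      (lebesgue_measure \x lebesgue_measure)%E (measurable_sqr_dist c))); last first.
  move=> A mA AD; apply: area_sqr_dist_preimage => //.
  by move=> x /AD; rewrite /= !in_itv/= => /andP[->].
rewrite ge0_integral_mscale//; last 2 first.
- exact: measurable_funTS.
- by move=> y _; rewrite lee_fin.
rewrite /= -[leRHS]mule1; apply: lee_wpmul2l; first by rewrite lee_fin ltW.
pose F (y : R) := - flat eta 0 (s - y).
have dF (y : R) : is_derive y 1 F (g y).
  have ds : is_derive y 1 (fun y => s - y) (-1).
    by have := is_deriveB (is_derive_cst s y 1) (is_derive_id y 1); rewrite sub0r.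
  have := is_deriveN (@is_derive1_comp _ _ (fun y => s - y) _ _ _
    (is_derive_flat eta 0 (s - y) eta0) ds).
  by rewrite mul0r subr0 mulrN1 opprK.
rewrite (@continuous_FTC2 R g F 0 s)//.
- rewrite /F subrr subr0 flat_le0// oppr0 sub0e -EFinN lee_fin opprK /flat s0.
  by rewrite expr0 mul1r -expR0 ler_expR oppr_le0 mulr_ge0// ?invr_ge0 ltW.
- exact: continuous_subspaceT.
- have cF x : {for x, continuous F}.
    by apply/differentiable_continuous/derivable1_diffP; exact: (@ex_derive _ _ _ _ _ _ _ (dF x)).
  split=> [x _||]; first exact: (@ex_derive _ _ _ _ _ _ _ (dF x)).
    exact/cvg_at_right_filter/cF.
  exact/cvg_at_left_filter/cF.
- by move=> x _; rewrite derive1E (@derive_val _ _ _ _ _ _ _ (dF x)).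
Qed.

Lemma partial_flat_bump {R : realType} (eta : R) (c : R * R) s b p : 0 < eta ->
  partial b (flat_bump eta 0 c s) p =
  -2 * (eta * flat_bump eta 2 c s p) * (if b then p.2 - c.2 else p.1 - c.1).
Proof.
move=> eta0; rewrite /partial.
rewrite (@derive_val _ _ _ _ _ _ _ (is_derive_flat_bump eta 0 c s p (axis b) eta0)).
by rewrite mul0r subr0 /axis; case: b => /=; ring.
Qed.

(** The gradient is a radial profile times [p - c], whose length is at most [rho] wherever the
    profile is nonzero. *)
Lemma enorm_grad_flat_bump_le {R : realType} (eta rho : R) (c : R * R) p :
  0 < eta -> 0 < rho ->
  enorm (grad (flat_bump eta 0 c (rho ^+ 2)) p) <=
  2 * rho * (eta * flat_bump eta 2 c (rho ^+ 2) p).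
Proof.
move=> eta0 rho0; rewrite /grad !partial_flat_bump//=.
have f0 : 0 <= eta * flat_bump eta 2 c (rho ^+ 2) p.
  by rewrite mulr_ge0 ?flat_ge0// ltW.
rewrite (enormZ _ (p - c)) normrM normrN (ger0_norm f0) ger0_norm//.
have [pc|pc] := ltP (enorm (p - c)) rho.
  by rewrite mulrAC ler_wpM2r// ler_pM2l// ltW.
rewrite /flat_bump flat_le0 ?mulr0 ?mul0r//.
by rewrite subr_le0 -(sqr_enorm (p - c)) ler_pXn2r ?nnegrE ?enorm_ge0// ltW.
Qed.

(** * The two-bump competitor *)

Lemma measurable_enorm_grad {R : realType} (eta : R) u : 0 < eta ->
  elementary eta u ->
  measurable_fun setT ((fun p => enorm (grad u p)) : plane R -> measurableTypeR R).
Proof.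
move=> eta0 eu.
have mp b : measurable_fun setT (partial b u : plane R -> measurableTypeR R).
  by apply: (elementary_measurable eta) => //; exact: elementary_partial.
apply: (@measurableT_comp _ _ _ _ _ _ (Num.sqrt : measurableTypeR R -> measurableTypeR R) setT
  (fun p => partial false u p ^+ 2 + partial true u p ^+ 2)).
  by apply: continuous_measurable_fun; exact: sqrt_continuous.
by apply: measurable_funD; apply: measurable_funX; exact: mp.
Qed.

Lemma measurable_powR_norm {R : realType} (eta : R) u : 0 < eta ->
  elementary eta u ->
  measurable_fun setT ((fun p => `|u p| `^ 2^-1) : plane R -> measurableTypeR R).
Proof.
move=> eta0 eu.
apply: (@measurableT_comp _ _ _ _ _ _
  ((fun x => x `^ 2^-1) : measurableTypeR R -> measurableTypeR R) setT
  (fun p => `|u p|)); first exact: measurable_powR.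
apply: (@measurableT_comp _ _ _ _ _ _ (Num.norm : measurableTypeR R -> measurableTypeR R) setT u).
  by apply: continuous_measurable_fun; exact: norm_continuous.
exact: (elementary_measurable eta).
Qed.

Lemma lambda1_le_quotient {R : realType} (eta : R) u (Omega : set (plane R)) (M G : R) :
  0 < eta -> elementary eta u -> measurable Omega ->
  compact (closed_support u) -> closed_support u `<=` Omega ->
  integral_plane Omega (fun p => `|u p| `^ 2^-1) = M%:E -> 0 < M ->
  (integral_plane Omega (fun p => enorm (grad u p)) <= G%:E)%E ->
  (lambda1 2^-1 Omega <= (G / M ^+ 2)%:E)%E.
Proof.
move=> eta0 eu mO cu uO uM M0 uG.
have m0 : 0 < M ^- 2 by rewrite invr_gt0 exprn_gt0.
(* Under the exponent 1/2 the factor becomes [M^-1], so [w] meets the constraint, while its gradient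
   scales by [M ^- 2]. *)
pose w p := M ^- 2 * u p.
have ew : elementary eta w by apply: elementaryM => //; exact: elementary_cst.
have gradw p : enorm (grad w p) = M ^- 2 * enorm (grad u p).
  have pw b : partial b w p = M ^- 2 * partial b u p.
    have [g _ dg] := elementary_derive eta _ (axis b) eta0 eu.
    rewrite /partial (@derive_val _ _ _ _ _ _ _ (dg p)).
    exact: (@derive_val _ _ _ _ _ _ _ (is_deriveZ (M ^- 2) (dg p))).
  by rewrite /grad !pw (enormZ _ (partial false u p, partial true u p)) gtr0_norm.
have suppw : closed_support w = closed_support u.
  congr closure; apply/seteqP; split=> p /=; rewrite /w mulf_eq0 negb_or.
    by case/andP.
  by move=> ->; rewrite gt_eqF.
apply: (@le_trans _ _ (integral_plane Omega (fun p => enorm (grad w p)))).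
  apply: ereal_inf_lbound; exists w => //; split.
    by split; [exact: elementary_smooth eta0 ew|rewrite suppw..].
  rewrite /integral_plane.
  transitivity (\int[lebesgue_measure \x lebesgue_measure]_(p in Omega)
      ((M^-1)%:E * (`|u p| `^ 2^-1)%:E))%E.
    apply: eq_integral => p _; rewrite -EFinM /w normrM powRM// (gtr0_norm m0).
    by rewrite (powR12_sqrt (ltW m0)) -exprVn sqrtr_sqr (@gtr0_norm _ M^-1) ?invr_gt0.
  rewrite ge0_integralZl ?lee_fin ?invr_ge0 ?(ltW M0)//.
  - by rewrite -/(integral_plane Omega _) uM -EFinM mulVf// gt_eqF.
  - by apply/measurable_EFinP; apply: measurable_funTS; exact: measurable_powR_norm eu.
rewrite /integral_plane; under eq_integral do rewrite gradw EFinM.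
rewrite ge0_integralZl ?lee_fin ?(ltW m0)//.
- by rewrite -/(integral_plane Omega _) mulrC EFinM lee_wpmul2l// lee_fin ltW.
- by apply/measurable_EFinP; apply: measurable_funTS; exact: measurable_enorm_grad eu.
- by move=> p _; rewrite lee_fin enorm_ge0.
Qed.

Lemma flat0_le1 {R : realType} (eta t : R) : 0 < eta -> flat eta 0 t <= 1.
Proof.
move=> eta0; rewrite /flat; case: ifPn => // t0.
by rewrite expr0 mul1r -expR0 ler_expR oppr_le0 mulr_ge0// ?invr_ge0 ltW.
Qed.

Lemma flat0_ge {R : realType} (eta x t : R) : 0 < t -> eta <= (1 - x) * t ->
  x <= flat eta 0 t.
Proof.
move=> t0 et; rewrite /flat t0 expr0 mul1r.
apply: le_trans (expR_ge1Dx _).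
have : eta * t^-1 <= 1 - x by rewrite ler_pdivrMr.
by lra.
Qed.

Lemma compact_closed_disk {R : realType} (c : R * R) (rho : R) :
  compact [set p | enorm (p - c) <= rho].
Proof.
apply: (@subclosed_compact _ _ (`[c.1 - rho, c.1 + rho]%classic `*`
    `[c.2 - rho, c.2 + rho]%classic)).
- exact: closed_closed_disk.
- by apply: compact_setX; exact: segment_compact.
- move=> p /= prho.
  have := le_trans (le_enorm1 _) prho; have := le_trans (le_enorm2 _) prho.
  rewrite !ler_norml /= => /andP[p1 p2] /andP[p3 p4].
  by split; rewrite /= in_itv/=; apply/andP; split; lra.
Qed.

Lemma flat_bump_support {R : realType} (eta : R) k (c : R * R) (rho : R) p :
  0 < rho -> flat_bump eta k c (rho ^+ 2) p != 0 -> enorm (p - c) <= rho.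
Proof.
move=> rho0; apply: contra_neqT; rewrite -ltNge => pc; apply: flat_le0.
by rewrite subr_le0 -(sqr_enorm (p - c)) ler_pXn2r ?nnegrE ?enorm_ge0// ltW.
Qed.

(** On the smaller disk the argument of [flat] is at least [(theta * r) ^+ 2 * (1 - theta ^+ 2)];
    the bound on [eta] then allows [expR (- y) >= 1 - y] to conclude. *)
Lemma flat_bump_ge {R : realType} (eta theta r : R) (c p : R * R) :
  0 < theta < 1 -> 0 < r ->
  eta <= (1 - theta ^+ 2) * ((theta * r) ^+ 2 * (1 - theta ^+ 2)) ->
  disk c (theta * (theta * r)) p ->
  theta ^+ 2 <= flat_bump eta 0 c ((theta * r) ^+ 2) p.
Proof.
move=> /andP[t0 t1] r0 eta_le; rewrite /disk/= enorm_lt ?mulr_gt0// => pc.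
have tt : 0 < 1 - theta ^+ 2 by rewrite subr_gt0 exprn_ilt1// ltW.
have le_t : (theta * r) ^+ 2 * (1 - theta ^+ 2) <=
    (theta * r) ^+ 2 - ((p.1 - c.1) ^+ 2 + (p.2 - c.2) ^+ 2).
  rewrite mulrBr mulr1 lerD2l lerN2 (mulrC _ (theta ^+ 2)) -exprMn.
  exact: ltW.
apply: flat0_ge; first by apply: lt_le_trans le_t; rewrite mulr_gt0// exprn_gt0// mulr_gt0.
by apply: (le_trans eta_le); rewrite ler_wpM2l// ltW.
Qed.

Lemma integral_plane_ge_cst {R : realType} (D : set (plane R)) (f : R * R -> R) (k : R) :
  measurable D -> 0 <= k ->
  measurable_fun setT (f : plane R -> measurableTypeR R) ->
  (forall p, D p -> k <= f p) ->
  (k%:E * area D <= integral_plane D f)%E.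
Proof.
move=> mD k0 mf kf; rewrite /area -integral_cst//; apply: ge0_le_integral => //.
by apply/measurable_EFinP; exact: measurable_funTS.
Qed.

Lemma integral_plane_le_cst {R : realType} (D : set (plane R)) (f : R * R -> R) (k : R) :
  measurable D -> measurable_fun setT (f : plane R -> measurableTypeR R) ->
  (forall p, 0 <= f p <= k) ->
  (integral_plane D f <= k%:E * area D)%E.
Proof.
move=> mD mf fk; rewrite /area -integral_cst//; apply: ge0_le_integral => //.
- by move=> p _; rewrite lee_fin; have /andP[] := fk p.
- by apply/measurable_EFinP; exact: measurable_funTS.
- by move=> p _; rewrite lee_fin; have /andP[] := fk p.
Qed.

Definition two_bumps {R : realType} (eta : R) (c1 c2 : R * R) (rho1 rho2 a1 a2 : R)
    (p : R * R) : R :=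
  a1 * flat_bump eta 0 c1 (rho1 ^+ 2) p + a2 * flat_bump eta 0 c2 (rho2 ^+ 2) p.

Section TwoBumps.
Context {R : realType} (eta : R) (c1 c2 : R * R) (rho1 rho2 a1 a2 : R).
Hypotheses (eta0 : 0 < eta) (rho10 : 0 < rho1) (rho20 : 0 < rho2)
  (a10 : 0 <= a1) (a20 : 0 <= a2).
Let u := two_bumps eta c1 c2 rho1 rho2 a1 a2.

Lemma elementary_two_bumps : elementary eta u.
Proof.
do ?[exact: elementary_cst|exact: elementary_flat_bump|apply: elementaryM|
     apply: elementaryD].
Qed.

Lemma two_bumps_ge0 p : 0 <= u p.
Proof. by rewrite addr_ge0// mulr_ge0// flat_ge0. Qed.

Lemma two_bumps_le p : u p <= a1 + a2.
Proof.
by apply: lerD; rewrite -[leRHS]mulr1 ler_wpM2l//; exact: flat0_le1.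
Qed.

Lemma two_bumps_support :
  closed_support u `<=` [set p | enorm (p - c1) <= rho1] `|`
    [set p | enorm (p - c2) <= rho2].
Proof.
set B := _ `|` _.
have clB : closed B by apply: closedU; exact: closed_closed_disk.
rewrite [B](closure_id _).1//; apply: closure_subset => p /= up.
have [f1|f1] := eqVneq (flat_bump eta 0 c1 (rho1 ^+ 2) p) 0; last first.
  by left; exact: flat_bump_support f1.
right; apply: (flat_bump_support eta 0) => //; apply: contra_neq up => f2.
by rewrite /u /two_bumps f1 f2 !mulr0 addr0.
Qed.

Lemma two_bumps_compact_support : compact (closed_support u).
Proof.
apply: (subclosed_compact _ _ two_bumps_support).
  exact: closed_closure.
by apply: compactU; exact: compact_closed_disk.
Qed.

Lemma enorm_grad_two_bumps_le p :
  enorm (grad u p) <=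
  a1 * (2 * rho1) * (eta * flat_bump eta 2 c1 (rho1 ^+ 2) p) +
  a2 * (2 * rho2) * (eta * flat_bump eta 2 c2 (rho2 ^+ 2) p).
Proof.
have pu b : partial b u p = a1 * partial b (flat_bump eta 0 c1 (rho1 ^+ 2)) p +
    a2 * partial b (flat_bump eta 0 c2 (rho2 ^+ 2)) p.
  have d1 := is_derive_flat_bump eta 0 c1 (rho1 ^+ 2) p (axis b) eta0.
  have d2 := is_derive_flat_bump eta 0 c2 (rho2 ^+ 2) p (axis b) eta0.
  rewrite /partial (@derive_val _ _ _ _ _ _ _ d1) (@derive_val _ _ _ _ _ _ _ d2).
  exact: (@derive_val _ _ _ _ _ _ _ (is_deriveD (is_deriveZ a1 d1) (is_deriveZ a2 d2))).
have -> : grad u p =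
    (a1 * (grad (flat_bump eta 0 c1 (rho1 ^+ 2)) p).1,
     a1 * (grad (flat_bump eta 0 c1 (rho1 ^+ 2)) p).2) +
    (a2 * (grad (flat_bump eta 0 c2 (rho2 ^+ 2)) p).1,
     a2 * (grad (flat_bump eta 0 c2 (rho2 ^+ 2)) p).2).
  by rewrite /grad !pu.
apply: (le_trans (enormD _ _)); rewrite !enormZ !ger0_norm// -!(mulrA a1) -!(mulrA a2).
by apply: lerD; apply: ler_wpM2l => //; exact: enorm_grad_flat_bump_le.
Qed.

Lemma integral_grad_two_bumps_le (D : set (plane R)) : measurable D ->
  (integral_plane D (fun p => enorm (grad u p)) <=
   (disk_const R * (a1 * (2 * rho1) + a2 * (2 * rho2)))%:E)%E.
Proof.
move=> mD.
have mf c s : measurable_fun D (fun p : plane R => (eta * flat_bump eta 2 c s p)%:E).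
  apply/measurable_EFinP; apply: measurable_funTS.
  apply: (elementary_measurable eta) => //.
  by apply: elementaryM; [exact: elementary_cst|exact: elementary_flat_bump].
have f0 c s p : 0 <= eta * flat_bump eta 2 c s p by rewrite mulr_ge0 ?flat_ge0// ltW.
have b10 : 0 <= a1 * (2 * rho1) by rewrite !mulr_ge0// ltW.
have b20 : 0 <= a2 * (2 * rho2) by rewrite !mulr_ge0// ltW.
apply: (@le_trans _ _ (\int[lebesgue_measure \x lebesgue_measure]_(p in D)
   ((a1 * (2 * rho1))%:E * (eta * flat_bump eta 2 c1 (rho1 ^+ 2) p)%:E +
    (a2 * (2 * rho2))%:E * (eta * flat_bump eta 2 c2 (rho2 ^+ 2) p)%:E))%E).
  apply: ge0_le_integral => //.
  - by move=> p _; rewrite lee_fin enorm_ge0.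
  - by apply/measurable_EFinP; apply: measurable_funTS;
      exact: (measurable_enorm_grad eta _ eta0 elementary_two_bumps).
  - by apply: emeasurable_funD; apply: measurable_funeM; exact: mf.
  - move=> p _; rewrite -!EFinM -EFinD lee_fin; exact: enorm_grad_two_bumps_le.
rewrite ge0_integralD//; last 4 first.
- by move=> p _; rewrite -EFinM lee_fin mulr_ge0.
- by apply: measurable_funeM; exact: mf.
- by move=> p _; rewrite -EFinM lee_fin mulr_ge0.
- by apply: measurable_funeM; exact: mf.
rewrite !(ge0_integralZl _ mD (mf _ _)) ?lee_fin//; try by move=> p _; rewrite lee_fin.
rewrite mulrDr EFinD.
by apply: leeD; rewrite (mulrC (disk_const R)) (EFinM _ (disk_const R));
  apply: lee_wpmul2l; rewrite ?lee_fin//;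
  apply: integral_flat_bump_le; rewrite ?exprn_gt0.
Qed.

End TwoBumps.

(** * Upper bound for [lambda1] and conclusion *)

Lemma bernoulli_ge {R : realType} (e : R) n : 0 <= e <= 1 ->
  1 - n%:R * e <= (1 - e) ^+ n.
Proof.
move=> /andP[e0 e1]; elim: n => [|n IH]; first by rewrite mul0r subr0 expr0.
have n0 : 0 <= n%:R :> R by [].
rewrite exprS -natr1; apply: (@le_trans _ _ ((1 - e) * (1 - n%:R * e))).
  by nra.
by rewrite ler_wpM2l// subr_ge0.
Qed.

Lemma area_disks_lty {R : realType} (c1 c2 : R * R) (r1 r2 : R) :
  0 < r1 -> 0 < r2 -> (area (disk c1 r1 `|` disk c2 r2) < +oo)%E.
Proof.
move=> r10 r20.
apply: (@le_lt_trans _ _ (area (disk c1 r1) + area (disk c2 r2))%E).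
  apply: (measureU2 (lebesgue_measure \x lebesgue_measure)%E); exact: measurable_disk.
by rewrite !area_disk// ltry.
Qed.

Lemma measurable_disks {R : realType} (c1 c2 : R * R) (r1 r2 : R) :
  measurable (disk c1 r1 `|` disk c2 r2 : set (plane R)).
Proof. by apply: measurableU; exact: measurable_disk. Qed.

(* Only the concentric disks of radii [theta ^+ 2 * r1] and [theta ^+ 2 * r2]
   are used: there the bumps are at least [theta ^+ 2]. *)
Lemma integral_two_bumps_ge {R : realType} (eta theta : R) (c1 c2 : R * R) (r1 r2 : R) :
  0 < eta -> 0 < theta < 1 -> 0 < r1 -> 0 < r2 -> r1 + r2 < enorm (c1 - c2) ->
  eta <= (1 - theta ^+ 2) * ((theta * r1) ^+ 2 * (1 - theta ^+ 2)) ->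
  eta <= (1 - theta ^+ 2) * ((theta * r2) ^+ 2 * (1 - theta ^+ 2)) ->
  ((disk_const R * theta ^+ 5 * (r1 ^+ 3 + r2 ^+ 3))%:E <=
   integral_plane (disk c1 r1 `|` disk c2 r2)
     (fun p => (`|two_bumps eta c1 c2 (theta * r1) (theta * r2) (r1 ^+ 2) (r2 ^+ 2) p|
                `^ 2^-1)%R))%E.
Proof.
move=> eta0 t01 r10 r20 far eta1 eta2; have /andP[t0 t1] := t01.
set u := two_bumps _ _ _ _ _ _ _; pose f p := `|u p| `^ 2^-1.
pose D1 := disk c1 (theta * (theta * r1)); pose D2 := disk c2 (theta * (theta * r2)).
have u0 p : 0 <= u p by exact: two_bumps_ge0 (exprn_ge0 _ (ltW r10)) (exprn_ge0 _ (ltW r20)) p.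
have mf : measurable_fun setT (f : plane R -> measurableTypeR R).
  by apply: (measurable_powR_norm eta) => //; exact: elementary_two_bumps.
have shrink r : 0 < r -> theta * (theta * r) <= r.
  by move=> r0; rewrite mulrA ger_pMl// mulr_ile1// ltW.
have D1r : D1 `<=` disk c1 r1 by move=> p /lt_le_trans; apply; exact: shrink.
have D2r : D2 `<=` disk c2 r2 by move=> p /lt_le_trans; apply; exact: shrink.
have sqrt_le r p : 0 < r -> (r * theta) ^+ 2 <= u p -> r * theta <= f p.
  move=> r0 rp; rewrite /f ger0_norm// powR12_sqrt//.
  rewrite -[leLHS]gtr0_norm ?mulr_gt0// -sqrtr_sqr.
  exact: ler_wsqrtr.
apply: (@le_trans _ _ (integral_plane (D1 `|` D2) f)); last first.
  apply: ge0_subset_integral.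
  - exact: measurable_disks.
  - exact: measurable_disks.
  - by apply/measurable_EFinP; exact: measurable_funTS.
  - by move=> p _; rewrite lee_fin powR_ge0.
  - by move=> p [/D1r|/D2r]; [left|right].
rewrite /integral_plane ge0_integral_setU; first last.
- apply/disj_setPS => p [p1 p2].
  have := disks_apart _ _ _ _ _ _ (ltW (D1r _ p1)) (ltW (D2r _ p2)).
  by rewrite subrr enorm0; lra.
- by move=> p _; rewrite lee_fin powR_ge0.
- by apply/measurable_EFinP; exact: measurable_funTS.
- exact: measurable_disk.
- exact: measurable_disk.
apply: (@le_trans _ _ ((r1 * theta)%:E * area D1 + (r2 * theta)%:E * area D2)%E).
  rewrite /D1 /D2 !area_disk ?mulr_gt0// -!EFinM -EFinD lee_fin.
  by rewrite le_eqVlt; apply/orP; left; apply/eqP; ring.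
apply: leeD; apply: integral_plane_ge_cst => //.
- exact: measurable_disk.
- by rewrite mulr_ge0// ltW.
- move=> p p1; apply: sqrt_le => //; rewrite exprMn.
  apply: (@le_trans _ _ (r1 ^+ 2 * flat_bump eta 0 c1 ((theta * r1) ^+ 2) p)).
    by rewrite ler_wpM2l ?exprn_ge0 ?(ltW r10)//; exact: flat_bump_ge.
  by rewrite lerDl mulr_ge0 ?flat_ge0// exprn_ge0// ltW.
- exact: measurable_disk.
- by rewrite mulr_ge0// ltW.
- move=> p p2; apply: sqrt_le => //; rewrite exprMn.
  apply: (@le_trans _ _ (r2 ^+ 2 * flat_bump eta 0 c2 ((theta * r2) ^+ 2) p)).
    by rewrite ler_wpM2l ?exprn_ge0 ?(ltW r20)//; exact: flat_bump_ge.
  by rewrite lerDr mulr_ge0 ?flat_ge0// exprn_ge0// ltW.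
Qed.

(** The gradient integral carries one factor [theta], from the radii of the bumps, and the mass
    carries [theta ^+ 5]; dividing by the square of the mass leaves [theta ^+ 9] in the
    denominator. *)
Lemma lambda1_disks_le {R : realType} (theta : R) (c1 c2 : R * R) (r1 r2 : R) :
  0 < theta < 1 -> 0 < r1 -> 0 < r2 -> r1 + r2 < enorm (c1 - c2) ->
  (lambda1 2^-1 (disk c1 r1 `|` disk c2 r2) <=
   (2 / (disk_const R * (theta ^+ 9 * (r1 ^+ 3 + r2 ^+ 3))))%:E)%E.
Proof.
move=> t01 r10 r20 far; have /andP[t0 t1] := t01; have k0 := @disk_const_gt0 R.
have tt : 0 < 1 - theta ^+ 2 by rewrite subr_gt0 exprn_ilt1// ltW.
pose e r := (1 - theta ^+ 2) * ((theta * r) ^+ 2 * (1 - theta ^+ 2)).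
have e_gt0 r : 0 < r -> 0 < e r by move=> r0; rewrite !mulr_gt0// exprn_gt0// mulr_gt0.
pose eta := Num.min (e r1) (e r2).
have eta0 : 0 < eta by rewrite lt_min !e_gt0.
have tr10 : 0 < theta * r1 by rewrite mulr_gt0.
have tr20 : 0 < theta * r2 by rewrite mulr_gt0.
have a10 : 0 <= r1 ^+ 2 by rewrite exprn_ge0// ltW.
have a20 : 0 <= r2 ^+ 2 by rewrite exprn_ge0// ltW.
(* For heights [a1] and [a2] the limiting quotient is proportional to [a1 * r1 + a2 * r2] over the
   square of [sqrt a1 * r1 ^+ 2 + sqrt a2 * r2 ^+ 2]. By Cauchy-Schwarz it is least when the heights
   are proportional to the squared radii. *)
pose u := two_bumps eta c1 c2 (theta * r1) (theta * r2) (r1 ^+ 2) (r2 ^+ 2).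
have eu : elementary eta u by exact: elementary_two_bumps.
have mO := measurable_disks c1 c2 r1 r2.
have := integral_two_bumps_ge eta theta c1 c2 r1 r2 eta0 t01 r10 r20 far.
rewrite -/u => /(_ ltac:(by rewrite /eta ge_min lexx) ltac:(by rewrite /eta ge_min lexx orbT)).
(* Finiteness lets the mass be a real number [M] by which to normalise. *)
have : (integral_plane (disk c1 r1 `|` disk c2 r2) (fun p => (`|u p| `^ 2^-1)%R) < +oo)%E.
  apply: (@le_lt_trans _ _ (((r1 ^+ 2 + r2 ^+ 2) `^ 2^-1)%:E *
      area (disk c1 r1 `|` disk c2 r2))%E).
    apply: integral_plane_le_cst => //; first exact: (measurable_powR_norm eta).
    move=> p; rewrite powR_ge0/=; apply: ge0_ler_powR; rewrite ?nnegrE ?invr_ge0//.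
      exact: addr_ge0.
    by rewrite ger0_norm ?two_bumps_ge0//; exact: two_bumps_le.
  by rewrite lte_mul_pinfty ?lee_fin ?powR_ge0//; exact: area_disks_lty.
case uM : (integral_plane _ _) => [M||] // _; rewrite lee_fin => leM.
have S0 : 0 < r1 ^+ 3 + r2 ^+ 3 by rewrite addr_gt0// exprn_gt0.
have M0 : 0 < M by apply: lt_le_trans leM; rewrite !mulr_gt0// exprn_gt0.
apply: (le_trans (lambda1_le_quotient eta u _ M _ eta0 eu mO _ _ uM M0
  (integral_grad_two_bumps_le _ _ _ _ _ _ _ eta0 tr10 tr20 a10 a20 _ mO))).
- exact: two_bumps_compact_support.
- move=> p /two_bumps_support[]// pr; [left|right].
    by apply: (le_lt_trans pr); rewrite gtr_pMl.
  by apply: (le_lt_trans pr); rewrite gtr_pMl.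
rewrite lee_fin.
apply: (@le_trans _ _
  (disk_const R * (r1 ^+ 2 * (2 * (theta * r1)) + r2 ^+ 2 * (2 * (theta * r2))) /
   (disk_const R * theta ^+ 5 * (r1 ^+ 3 + r2 ^+ 3)) ^+ 2)).
  apply: ler_wpM2l.
    by rewrite mulr_ge0 ?(ltW k0)// addr_ge0// !mulr_ge0// ltW.
  rewrite lef_pV2 ?posrE ?exprn_gt0 ?mulr_gt0 ?exprn_gt0//.
  by rewrite ler_pXn2r// nnegrE ?(ltW M0)// ltW// !mulr_gt0// exprn_gt0.
rewrite le_eqVlt; apply/orP; left; apply/eqP; field.
by rewrite !gt_eqF.
Qed.

Lemma exists_theta {R : realType} (r1 r2 : R) : 0 < r1 -> 0 < r2 ->
  exists2 theta : R, 0 < theta < 1 & r2 ^+ 3 < theta ^+ 9 * (r1 ^+ 3 + r2 ^+ 3).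
Proof.
move=> r10 r20; have c1 : 0 < r1 ^+ 3 by rewrite exprn_gt0.
have c2 : 0 < r2 ^+ 3 by rewrite exprn_gt0.
have S0 : 0 < r1 ^+ 3 + r2 ^+ 3 by rewrite addr_gt0.
(* By Bernoulli's inequality passing to [theta = 1 - e] costs at most [9 * e * (r1 ^+ 3 + r2 ^+ 3)],
   which is half of the available margin [r1 ^+ 3]. *)
pose e := r1 ^+ 3 / (18 * (r1 ^+ 3 + r2 ^+ 3)).
have e0 : 0 < e by rewrite divr_gt0// mulr_gt0.
have eS : e * (r1 ^+ 3 + r2 ^+ 3) = r1 ^+ 3 / 18 by rewrite /e; field; rewrite gt_eqF.
have e1 : e < 1 by rewrite ltr_pdivrMr ?mulr_gt0//; lra.
exists (1 - e); first by apply/andP; split; lra.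
apply: (@lt_le_trans _ _ ((1 - 9%:R * e) * (r1 ^+ 3 + r2 ^+ 3))).
  by rewrite mulrBl mul1r -mulrA eS; lra.
by rewrite ler_pM2r//; apply: bernoulli_ge; rewrite !ltW.
Qed.

Theorem mainTheorem6 (F : realType) (x0 y0 : F * F) (r R : F)
    (r_gt0 : 0 < r) (R_gt0 : 0 < R)
    (far : r + R < enorm (x0 - y0))
    (ratio : r / R < (Num.sqrt 7 - 2) / 3) :
  (lambda1 2^-1 (disk x0 r `|` disk y0 R)
     < cheeger_const 2^-1 (disk x0 r `|` disk y0 R))%E.
Proof.
(* The strict gap comes from the extra [r ^+ 3] that the small disk contributes to the denominator
   of the upper bound; [theta] is taken close enough to 1 to keep it. *)
have [theta t01 lt_theta] := exists_theta r R r_gt0 R_gt0.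
have k0 := @disk_const_gt0 F.
apply: le_lt_trans (lambda1_disks_le theta x0 y0 r R t01 r_gt0 R_gt0 far) _.
apply: lt_le_trans (cheeger_const_disks_ge x0 y0 r R r_gt0 R_gt0 far
  (radii_ratio r R r_gt0 R_gt0 ratio)).
have R3 : 0 < R ^+ 3 by rewrite exprn_gt0.
have pos9 := lt_trans R3 lt_theta.
by rewrite lte_fin ltr_pM2l// ltf_pV2 ?ltr_pM2l// posrE mulr_gt0.
Qed.
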